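(* Let $d\ge 1$. Define $X_d\in U(\mathfrak{g})^K$ by $$X_d=\sum_{S\in\mathcal{I}^m_d}\ \sum_{l=0}^d\ \sum_{S',S'',T',T''}(-1)^{l(S',S'')+l(T',T'')}\det(\mathbf{E}^X_{S',T'};\alpha)\,\det(({}^t\mathbf{E}^Y)_{S'',T''};\beta),$$ where the third summation is over $S',T'\in\mathcal{I}^m_l$ and $S'',T''\in\mathcal{I}^m_{d-l}$ with $S=S'\amalg S''=T'\amalg T''$, and $$\alpha=\left(l-1-\tfrac p2,\ l-2-\tfrac p2,\ \ldots,\ -\tfrac p2\right),\qquad \beta=\left(-(d-l-1)+\tfrac q2,\ -(d-l-2)+\tfrac q2,\ \ldots,\ \tfrac q2\right).$$ Define $C_d\in U(\mathfrak{m})^H$ by $$C_d=\sum_{J\in\mathcal{I}^{p+q}_d}\mathrm{Det}_{p,q}\left(\left(\mathbf{B}-\tfrac m2 I_{p,q}\right)_{J,J};\ d-1,d-2,\ldots,0\right).$$ Then $$\omega(X_d)=\sum_{S\in\mathcal{I}^m_d,\ J\in\mathcal{I}^{p+q}_d}\det P_{S,J}\,\det Q_{S,J}=\omega(C_d).$$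
   Context: Let $m$ be a positive integer and $p,q$ non-negative integers. Let $V=\mathrm{Mat}(m,p;\mathbb{C})\oplus\mathrm{Mat}(m,q;\mathbb{C})$ with linear coordinates $x_{s,i}$ ($1\le s\le m$, $1\le i\le p$) and $y_{s,i}$ ($1\le s\le m$, $1\le i\le q$), and let $\mathcal{PD}(V)$ be the ring of differential operators with polynomial coefficients on $V$. Put $\partial^X_{s,i}=\partial/\partial x_{s,i}$, $\partial^Y_{s,i}=\partial/\partial y_{s,i}$, and let $X=(x_{s,i})$, $\partial^X=(\partial^X_{s,i})$, $Y=(y_{s,i})$, $\partial^Y=(\partial^Y_{s,i})$. Put $P=(X,\partial^Y)$ and $Q=(\partial^X,Y)$, which are $m\times(p+q)$ matrices with entries in $\mathcal{PD}(V)$. The entries of $P$ commute with each other, and so do those of $Q$, so their minors are ordinary determinants. For $n,d\ge 0$, $\mathcal{I}^n_d$ is the set of $d$-element subsets of $\{1,\ldots,n\}$; elements of $S\in\mathcal{I}^n_d$ are written in increasing order $S(1)<\cdots<S(d)$. $A_{S,T}$ denotes the submatrix of $A$ with rows in $S$ and columns in $T$. For disjoint index sets $S',S''$, $l(S',S'')$ is the number of inversions of the concatenated sequence $(S',S'')$. Empty determinants are $1$. $I_{p,q}=\mathrm{diag}(1_p,-1_q)$. ${}^tA$ is the transpose. Lie algebras: $\mathfrak{g}=\mathfrak{gl}_m(\mathbb{C})\oplus\mathfrak{gl}_m(\mathbb{C})$, and $K=GL_m(\mathbb{C})$ acts on $U(\mathfrak{g})$ by the adjoint action, with Lie algebra $\mathfrak{k}=\{(A,-{}^tA)\}\subset\mathfrak{g}$.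 $\mathfrak{m}=\mathfrak{gl}_{p+q}(\mathbb{C})$, and $H=GL_p(\mathbb{C})\times GL_q(\mathbb{C})$ (block diagonal) acts on $U(\mathfrak{m})$ by the adjoint action. $U(\mathfrak{g})^K$ and $U(\mathfrak{m})^H$ are the invariant subalgebras. Writing $E_{a,b}$ for matrix units, put $\mathbf{E}^X=((E_{s,t},0))_{1\le s,t\le m}$, $\mathbf{E}^Y=((0,E_{s,t}))_{1\le s,t\le m}$ (matrices over $U(\mathfrak{g})$), $\mathbf{B}'=(E_{i,j})_{1\le i,j\le p+q}$ and $\mathbf{B}=D\mathbf{B}'D$ with $D=\mathrm{diag}(1_p,-\sqrt{-1}\,1_q)$ (matrices over $U(\mathfrak{m})$). Weil representation: $\omega$ denotes both algebra homomorphisms $U(\mathfrak{g})\to\mathcal{PD}(V)$ and $U(\mathfrak{m})\to\mathcal{PD}(V)$ determined by $\omega((E_{s,t},0))=\sum_{i=1}^p x_{s,i}\partial^X_{t,i}+\frac p2\delta_{s,t}$, $\ \omega((0,E_{s,t}))=\sum_{i=1}^q y_{s,i}\partial^Y_{t,i}+\frac q2\delta_{s,t}$, and, in block form of size $p+q$, $\omega\begin{pmatrix}E_{i,j}&0\\0&0\end{pmatrix}=\sum_{s=1}^m x_{s,i}\partial^X_{s,j}+\frac m2\delta_{i,j}$, $\ \omega\begin{pmatrix}0&0\\0&E_{i,j}\end{pmatrix}=-\sum_{s=1}^m y_{s,j}\partial^Y_{s,i}-\frac m2\delta_{i,j}$, $\ \omega\begin{pmatrix}0&E_{i,j}\\0&0\end{pmatrix}=\sqrt{-1}\sum_{s=1}^m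 x_{s,i}y_{s,j}$, $\ \omega\begin{pmatrix}0&0\\ E_{j,i}&0\end{pmatrix}=\sqrt{-1}\sum_{s=1}^m\partial^X_{s,i}\partial^Y_{s,j}$. Column-determinant with diagonal parameters $u=(u_1,\ldots,u_l)$: for an $m\times m$ matrix $A$ (entries in a possibly noncommutative ring) and $S',T'\in\mathcal{I}^m_l$, $$\det(A_{S',T'};u)=\sum_{\sigma\in\mathfrak{S}_l}\mathrm{sgn}(\sigma)\prod_{k=1}^{l}\left(A_{S'(\sigma(k)),T'(k)}+u_k\,\delta_{S'(\sigma(k)),T'(k)}\right),$$ the product being in the order $k=1,2,\ldots,l$ from left to right. Symmetrized minor with uneven diagonal shift: with $\varepsilon=-I_{p,q}$ (entries $\varepsilon_{i,j}$), for a $(p+q)\times(p+q)$ matrix $B$, $I=\{i_1<\cdots<i_d\}$, $J=\{j_1<\cdots<j_d\}$ in $\mathcal{I}^{p+q}_d$ and $u=(u_1,\ldots,u_d)$, $$\mathrm{Det}_{p,q}(B_{I,J};u)=\frac1{d!}\sum_{\sigma,\tau\in\mathfrak{S}_d}\mathrm{sgn}(\sigma)\,\mathrm{sgn}(\tau)\prod_{k=1}^d\left(B_{i_{\sigma(k)},j_{\tau(k)}}-u_k\,\varepsilon_{i_{\sigma(k)},j_{\tau(k)}}\right),$$ again with factors in the order $k=1,\ldots,d$. *)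

(* Defs.v *)
From HB Require Import structures.
From mathcomp Require Import all_boot perm all_algebra ring.
From mathcomp Require Import boolp reals complex mpoly.

Set Implicit Arguments.
Unset Strict Implicit.
Unset Printing Implicit Defensive.

Import GRing.Theory Num.Theory.
Local Open Scope ring_scope.
Local Open Scope quotient_scope.

HB.mixin Record isLieAlgebra (K : comNzRingType) L of GRing.Lmodule K L := {
  lie : L -> L -> L;
  lie_linearl : forall y : L, linear (lie^~ y);
  liexx : forall x : L, lie x x = 0;
  lie_jacobi : forall x y z : L,
    lie x (lie y z) + lie y (lie z x) + lie z (lie x y) = 0
}.

#[short(type="lieType")]
HB.structure Definition LieAlgebra (K : comNzRingType) :=
  { L of GRing.Lmodule K L & isLieAlgebra K L }.

Section GL.
Variables (K : comNzRingType) (n : nat).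

Definition gl_lie (A B : 'M[K]_n) : 'M[K]_n := A *m B - B *m A.

Fact gl_lie_linearl (B : 'M[K]_n) : linear (gl_lie^~ B).
Proof.
move=> a A1 A2; rewrite /gl_lie mulmxDl mulmxDr -scalemxAl -scalemxAr.
by rewrite scalerBr opprD addrACA.
Qed.

Fact gl_liexx (A : 'M[K]_n) : gl_lie A A = 0.
Proof. exact: subrr. Qed.

Fact gl_lie_jacobi (A B C : 'M[K]_n) :
  gl_lie A (gl_lie B C) + gl_lie B (gl_lie C A) + gl_lie C (gl_lie A B) = 0.
Proof.
rewrite /gl_lie !mulmxBr !mulmxBl !mulmxA !opprB.
move: (A *m B *m C) (A *m C *m B) (B *m A *m C) (B *m C *m A) (C *m A *m B)
  (C *m B *m A) => a b c d e f.
by apply/matrixP=> i j; rewrite !mxE; ring.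
Qed.

HB.instance Definition _ := isLieAlgebra.Build K 'M[K]_n
  gl_lie_linearl gl_liexx gl_lie_jacobi.

End GL.

Section LieProd.
Variables (K : comNzRingType) (L1 L2 : lieType K).
Implicit Types x y z : (L1 * L2)%type.

Definition lie_prod x y : L1 * L2 := (lie x.1 y.1, lie x.2 y.2).

Fact lie_prod_linearl y : linear (lie_prod^~ y).
Proof. by move=> a x1 x2; rewrite /lie_prod !lie_linearl. Qed.

Fact lie_prodxx x : lie_prod x x = 0.
Proof. by rewrite /lie_prod !liexx. Qed.

Fact lie_prod_jacobi x y z :
  lie_prod x (lie_prod y z) + lie_prod y (lie_prod z x)
    + lie_prod z (lie_prod x y) = 0.
Proof.
by apply/pair_equal_spec; split; rewrite /= lie_jacobi.
Qed.

HB.instance Definition _ := isLieAlgebra.Build K (L1 * L2)%type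
  lie_prod_linearl lie_prodxx lie_prod_jacobi.
End LieProd.

(* Lie algebra homomorphisms into the commutator Lie algebra of A. *)
Definition lie_morphism (K : comNzRingType) (L : lieType K) (A : algType K)
    (f : L -> A) :=
  linear f /\ forall x y : L, f (lie x y) = f x * f y - f y * f x.

Section Uea.
Variables (K : comNzRingType) (L : lieType K).

(* U(L) is the associative unital K-algebra presented by the generators of L:
   formal expressions modulo the congruence generated by the algebra axioms,
   the linearity of L -> U(L) and xy - yx = [x, y]. *)
Inductive uea_term :=
  | UConst of K
  | UGen of L
  | UAdd of uea_term & uea_term
  | UMul of uea_term & uea_term.

Inductive uea_rel : uea_term -> uea_term -> Prop :=
  | urefl a : uea_rel a a
  | usym a b : uea_rel a b -> uea_rel b a
  | utrans b a c : uea_rel a b -> uea_rel b c -> uea_rel a c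
  | uaddW a a' b b' :
      uea_rel a a' -> uea_rel b b' -> uea_rel (UAdd a b) (UAdd a' b')
  | umulW a a' b b' :
      uea_rel a a' -> uea_rel b b' -> uea_rel (UMul a b) (UMul a' b')
  | uaddA a b c : uea_rel (UAdd a (UAdd b c)) (UAdd (UAdd a b) c)
  | uaddC a b : uea_rel (UAdd a b) (UAdd b a)
  | uadd0 a : uea_rel (UAdd (UConst 0) a) a
  | uaddN a : uea_rel (UAdd (UMul (UConst (-1)) a) a) (UConst 0)
  | umulA a b c : uea_rel (UMul a (UMul b c)) (UMul (UMul a b) c)
  | umul1 a : uea_rel (UMul (UConst 1) a) a
  | umulDl a b c : uea_rel (UMul (UAdd a b) c) (UAdd (UMul a c) (UMul b c))
  | umulDr a b c : uea_rel (UMul a (UAdd b c)) (UAdd (UMul a b) (UMul a c))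
  | uconstD k l : uea_rel (UConst (k + l)) (UAdd (UConst k) (UConst l))
  | uconstM k l : uea_rel (UConst (k * l)) (UMul (UConst k) (UConst l))
  | uconstC k a : uea_rel (UMul (UConst k) a) (UMul a (UConst k))
  | ugenP k x y :
      uea_rel (UGen (k *: x + y)) (UAdd (UMul (UConst k) (UGen x)) (UGen y))
  | ugen_lie x y :
      uea_rel (UAdd (UMul (UGen x) (UGen y))
                    (UMul (UConst (-1)) (UMul (UGen y) (UGen x))))
              (UGen (lie x y)).

HB.instance Definition _ := gen_eqMixin uea_term.
HB.instance Definition _ := gen_choiceMixin uea_term.

Definition uea_equiv (a b : uea_term) : bool := `[< uea_rel a b >].

Fact uea_equiv_refl : reflexive uea_equiv.
Proof. by move=> a; apply/asboolP/urefl. Qed.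
Fact uea_equiv_sym : ssrbool.symmetric uea_equiv.
Proof. by move=> a b; apply/asboolP/asboolP; apply: usym. Qed.
Fact uea_equiv_trans : transitive uea_equiv.
Proof.
by move=> b a c /asboolP ab /asboolP bc; apply/asboolP; apply: utrans ab bc.
Qed.

Canonical uea_equivRel :=
  EquivRel uea_equiv uea_equiv_refl uea_equiv_sym uea_equiv_trans.

Definition uea : Type := {eq_quot uea_equivRel}.
HB.instance Definition _ := Choice.on uea.
HB.instance Definition _ := EqQuotient.on uea.

Definition uea_pi (a : uea_term) : uea := \pi_uea a.

Lemma uea_pi_eq a b : uea_rel a b -> uea_pi a = uea_pi b.
Proof. by move=> h; apply/eqquotP/asboolP. Qed.

Lemma uea_rel_repr a : uea_rel (repr (uea_pi a)) a.
Proof. by apply/asboolP; have /eqquotP := reprK (uea_pi a). Qed.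

Lemma uea_piW (P : uea -> Prop) : (forall a, P (uea_pi a)) -> forall u, P u.
Proof. by move=> hP u; rewrite -[u]reprK; apply: hP. Qed.

Definition uea_const (k : K) : uea := uea_pi (UConst k).
Definition uea_gen (x : L) : uea := uea_pi (UGen x).
Definition uea_add (u v : uea) : uea := uea_pi (UAdd (repr u) (repr v)).
Definition uea_mul (u v : uea) : uea := uea_pi (UMul (repr u) (repr v)).
Definition uea_opp (u : uea) : uea := uea_mul (uea_const (-1)) u.
Definition uea_scale (k : K) (u : uea) : uea := uea_mul (uea_const k) u.

Lemma uea_addE a b : uea_add (uea_pi a) (uea_pi b) = uea_pi (UAdd a b).
Proof. by apply/uea_pi_eq/uaddW; apply: uea_rel_repr. Qed.
Lemma uea_mulE a b : uea_mul (uea_pi a) (uea_pi b) = uea_pi (UMul a b).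
Proof. by apply/uea_pi_eq/umulW; apply: uea_rel_repr. Qed.

Fixpoint uea_eval (A : algType K) (f : L -> A) (a : uea_term) : A :=
  match a with
  | UConst k => k%:A
  | UGen x => f x
  | UAdd a b => uea_eval f a + uea_eval f b
  | UMul a b => uea_eval f a * uea_eval f b
  end.

Lemma uea_eval_rel (A : algType K) (f : L -> A) : lie_morphism f ->
  forall a b, uea_rel a b -> uea_eval f a = uea_eval f b.
Proof.
move=> [f_lin f_lie] a b; elim=> //=.
- by move=> ? ? ? _ -> _ ->.
- by move=> ? ? ? ? _ -> _ ->.
- by move=> ? ? ? ? _ -> _ ->.
- by move=> *; rewrite addrA.
- by move=> *; rewrite addrC.
- by move=> *; rewrite scale0r add0r.
- by move=> *; rewrite scaleN1r mulN1r addNr scale0r.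
- by move=> *; rewrite mulrA.
- by move=> *; rewrite scale1r mul1r.
- by move=> *; rewrite mulrDl.
- by move=> *; rewrite mulrDr.
- by move=> *; rewrite scalerDl.
- by move=> *; rewrite mulr_algl scalerA.
- by move=> *; rewrite mulr_algl mulr_algr.
- by move=> *; rewrite f_lin mulr_algl.
- by move=> *; rewrite f_lie scaleN1r mulN1r.
Qed.

Fact uea_addA : associative uea_add.
Proof.
elim/uea_piW=> a; elim/uea_piW=> b; elim/uea_piW=> c; rewrite !uea_addE; apply: uea_pi_eq; apply: uaddA.
Qed.
Fact uea_addC : commutative uea_add.
Proof.
elim/uea_piW=> a; elim/uea_piW=> b; rewrite !uea_addE; apply: uea_pi_eq; apply: uaddC.
Qed.
Fact uea_add0 : left_id (uea_const 0) uea_add.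
Proof. elim/uea_piW=> a; rewrite uea_addE; apply: uea_pi_eq; apply: uadd0. Qed.
Fact uea_addN : left_inverse (uea_const 0) uea_opp uea_add.
Proof.
elim/uea_piW=> a; rewrite /uea_opp; rewrite uea_mulE uea_addE; apply: uea_pi_eq; apply: uaddN.
Qed.

HB.instance Definition _ := GRing.isZmodule.Build uea
  uea_addA uea_addC uea_add0 uea_addN.

Fact uea_mulA : associative uea_mul.
Proof.
elim/uea_piW=> a; elim/uea_piW=> b; elim/uea_piW=> c; rewrite !uea_mulE; apply: uea_pi_eq; apply: umulA.
Qed.
Fact uea_mul1 : left_id (uea_const 1) uea_mul.
Proof. elim/uea_piW=> a; rewrite uea_mulE; apply: uea_pi_eq; apply: umul1. Qed.
Fact uea_constC k u : uea_mul (uea_const k) u = uea_mul u (uea_const k).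
Proof. elim/uea_piW: u => a; rewrite !uea_mulE; apply: uea_pi_eq; apply: uconstC. Qed.
Fact uea_mulr1 : right_id (uea_const 1) uea_mul.
Proof. by move=> u; rewrite -uea_constC uea_mul1. Qed.
Fact uea_mulDl : left_distributive uea_mul +%R.
Proof.
elim/uea_piW=> a; elim/uea_piW=> b; elim/uea_piW=> c; rewrite /GRing.add /=; rewrite uea_addE !uea_mulE uea_addE; apply: uea_pi_eq; apply: umulDl.
Qed.
Fact uea_mulDr : right_distributive uea_mul +%R.
Proof.
elim/uea_piW=> a; elim/uea_piW=> b; elim/uea_piW=> c; rewrite /GRing.add /=; rewrite uea_addE !uea_mulE uea_addE; apply: uea_pi_eq; apply: umulDr.
Qed.
Fact uea_1neq0 : uea_const 1 != 0.
Proof.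
have f0 : lie_morphism (fun _ : L => 0 : K^o).
  by split=> [k x y|x y]; rewrite ?scaler0 ?addr0 // mulr0 subr0.
apply/eqP=> /eqquotP/asboolP/(uea_eval_rel f0) /= /eqP.
by rewrite scale1r scale0r oner_eq0.
Qed.

HB.instance Definition _ := GRing.Zmodule_isNzRing.Build uea
  uea_mulA uea_mul1 uea_mulr1 uea_mulDl uea_mulDr uea_1neq0.

Fact uea_scaleA k l u : uea_scale k (uea_scale l u) = uea_scale (k * l) u.
Proof.
rewrite /uea_scale uea_mulA; congr uea_mul.
by rewrite uea_mulE; apply/esym/uea_pi_eq/uconstM.
Qed.
Fact uea_scaleDl u : {morph uea_scale^~ u : k l / k + l}.
Proof.
move=> k l; rewrite /uea_scale -uea_mulDl; congr uea_mul.
by rewrite /GRing.add /= uea_addE; apply/uea_pi_eq/uconstD.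
Qed.

HB.instance Definition _ := GRing.Zmodule_isLmodule.Build K uea
  uea_scaleA uea_mul1 (fun k u v => uea_mulDr (uea_const k) u v) uea_scaleDl.

Fact uea_scaleAl k (u v : uea) : k *: (u * v) = (k *: u) * v.
Proof. exact: uea_mulA. Qed.
HB.instance Definition _ := GRing.Lmodule_isLalgebra.Build K uea uea_scaleAl.
Fact uea_scaleAr k (u v : uea) : k *: (u * v) = u * (k *: v).
Proof.
change (uea_mul (uea_const k) (uea_mul u v) = uea_mul u (uea_mul (uea_const k) v)).
by rewrite 2!uea_mulA (uea_constC k u).
Qed.
HB.instance Definition _ := GRing.Lalgebra_isAlgebra.Build K uea uea_scaleAr.

Lemma uea_gen_morphism : lie_morphism uea_gen.
Proof.
split=> [k x y|x y].
  change (uea_pi (UGen (k *: x + y)) =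
    uea_add (uea_mul (uea_pi (UConst k)) (uea_pi (UGen x))) (uea_pi (UGen y))).
  by rewrite uea_mulE uea_addE; apply: uea_pi_eq; apply: ugenP.
change (uea_pi (UGen (lie x y)) =
  uea_add (uea_mul (uea_pi (UGen x)) (uea_pi (UGen y)))
    (uea_mul (uea_pi (UConst (-1)))
       (uea_mul (uea_pi (UGen y)) (uea_pi (UGen x))))).
rewrite (uea_mulE (UGen x)) (uea_mulE (UGen y)) uea_mulE uea_addE.
by apply/esym; apply: uea_pi_eq; apply: ugen_lie.
Qed.

HB.instance Definition _ :=
  GRing.isLinear.Build K L uea *:%R uea_gen uea_gen_morphism.1.

Section Lift.
Variables (A : algType K) (f : L -> A).

(* Total in f; meaningful when f is a Lie algebra homomorphism. *)
Definition uea_lift (u : uea) : A := uea_eval f (repr u).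

Hypothesis f_lie : lie_morphism f.

Lemma uea_lift_pi a : uea_lift (uea_pi a) = uea_eval f a.
Proof. exact/(uea_eval_rel f_lie)/uea_rel_repr. Qed.

Lemma uea_lift_gen x : uea_lift (uea_gen x) = f x.
Proof. exact: uea_lift_pi. Qed.

Lemma uea_lift_linear : linear uea_lift.
Proof.
move=> k; elim/uea_piW=> a; elim/uea_piW=> b.
rewrite (uea_lift_pi a) (uea_lift_pi b) -[k *: uea_eval f a]mulr_algl.
change (uea_lift (uea_add (uea_mul (uea_pi (UConst k)) (uea_pi a)) (uea_pi b))
  = uea_eval f (UAdd (UMul (UConst k) a) b)).
by rewrite uea_mulE uea_addE uea_lift_pi.
Qed.

Lemma uea_lift_monoid : monoid_morphism uea_lift.
Proof.
split=> [|]; first by rewrite [LHS]uea_lift_pi /= scale1r.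
elim/uea_piW=> a; elim/uea_piW=> b; rewrite (uea_lift_pi a) (uea_lift_pi b).
by rewrite -[RHS](uea_lift_pi (UMul a b)) -uea_mulE.
Qed.

Lemma uea_lift_uniq (h : {lrmorphism uea -> A}) :
  (forall x, h (uea_gen x) = f x) -> h =1 uea_lift.
Proof.
move=> hf; elim/uea_piW=> a; rewrite uea_lift_pi.
have hC k : h (uea_pi (UConst k)) = k%:A.
  rewrite -[k%:A](rmorph_alg h); congr (h _).
  exact: esym (uea_mulr1 (uea_const k)).
elim: a => [k|x|a IHa b IHb|a IHa b IHb] //=.
- exact: hf.
- by rewrite -IHa -IHb -rmorphD -uea_addE.
- by rewrite -IHa -IHb -rmorphM -uea_mulE.
Qed.

End Lift.
End Uea.

Section Endo.
Variables (K : comNzRingType) (V : lalgType K).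

(* K-linear endomorphisms; V is an algebra only to ensure id <> 0. *)
Record endo : Type := Endo { endo_fun :> V -> V; _ : linear endo_fun }.
Implicit Types f g h : endo.

HB.instance Definition _ := gen_eqMixin endo.
HB.instance Definition _ := gen_choiceMixin endo.

Lemma endo_linear f : linear f. Proof. by case: f. Qed.
HB.instance Definition _ f := GRing.isLinear.Build K V V *:%R f (endo_linear f).

Lemma endoP f g : f =1 g -> f = g.
Proof.
case: f g => [f hf] [g hg] /= /funext fg.
by subst g; congr Endo; apply: Prop_irrelevance.
Qed.

Fact endo_zero_subproof : linear (fun _ : V => 0 : V).
Proof. by move=> k u v; rewrite scaler0 addr0. Qed.
Fact endo_opp_subproof f : linear (fun v => - f v).
Proof. by move=> k u v; rewrite linearP opprD scalerN. Qed.
Fact endo_add_subproof f g : linear (fun v => f v + g v).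
Proof. by move=> k u v; rewrite !linearP scalerDr addrACA. Qed.
Fact endo_one_subproof : linear (fun v : V => v).
Proof. by []. Qed.
Fact endo_mul_subproof f g : linear (fun v => f (g v)).
Proof. by move=> k u v; rewrite !linearP. Qed.

Definition endo_zero := Endo endo_zero_subproof.
Definition endo_opp f := Endo (endo_opp_subproof f).
Definition endo_add f g := Endo (endo_add_subproof f g).
Definition endo_one := Endo endo_one_subproof.
Definition endo_mul f g := Endo (endo_mul_subproof f g).

Fact endo_addA : associative endo_add.
Proof. by move=> f g h; apply: endoP => v /=; rewrite addrA. Qed.
Fact endo_addC : commutative endo_add.
Proof. by move=> f g; apply: endoP => v /=; rewrite addrC. Qed.
Fact endo_add0 : left_id endo_zero endo_add.
Proof. by move=> f; apply: endoP => v /=; rewrite add0r. Qed.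
Fact endo_addN : left_inverse endo_zero endo_opp endo_add.
Proof. by move=> f; apply: endoP => v /=; rewrite addNr. Qed.
HB.instance Definition _ := GRing.isZmodule.Build endo
  endo_addA endo_addC endo_add0 endo_addN.

Fact endo_mulA : associative endo_mul.
Proof. by move=> f g h; apply: endoP. Qed.
Fact endo_mul1 : left_id endo_one endo_mul.
Proof. by move=> f; apply: endoP. Qed.
Fact endo_mulr1 : right_id endo_one endo_mul.
Proof. by move=> f; apply: endoP. Qed.
Fact endo_mulDl : left_distributive endo_mul +%R.
Proof. by move=> f g h; apply: endoP. Qed.
Fact endo_mulDr : right_distributive endo_mul +%R.
Proof. by move=> f g h; apply: endoP => v /=; rewrite linearD. Qed.
Fact endo_1neq0 : endo_one != 0.
Proof.
by apply/eqP=> /(congr1 (fun f : endo => f 1)) /= /eqP; rewrite oner_eq0.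
Qed.
HB.instance Definition _ := GRing.Zmodule_isNzRing.Build endo
  endo_mulA endo_mul1 endo_mulr1 endo_mulDl endo_mulDr endo_1neq0.

End Endo.

Section EndoAlg.
Variables (K : comNzRingType) (V : lalgType K).
Implicit Types f g : endo V.

Fact endo_scale_subproof k f : linear (fun v => k *: f v).
Proof.
by move=> l u v; rewrite linearP scalerDr !scalerA mulrC.
Qed.
Definition endo_scale k f := Endo (endo_scale_subproof k f).

Fact endo_scaleA k l f : endo_scale k (endo_scale l f) = endo_scale (k * l) f.
Proof. by apply: endoP => v /=; rewrite scalerA. Qed.
Fact endo_scale1 : left_id 1 endo_scale.
Proof. by move=> f; apply: endoP => v /=; rewrite scale1r. Qed.
Fact endo_scaleDr : right_distributive endo_scale +%R.
Proof. by move=> k f g; apply: endoP => v /=; rewrite scalerDr. Qed.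
Fact endo_scaleDl f : {morph endo_scale^~ f : k l / k + l}.
Proof. by move=> k l; apply: endoP => v /=; rewrite scalerDl. Qed.
HB.instance Definition _ := GRing.Zmodule_isLmodule.Build K (endo V)
  endo_scaleA endo_scale1 endo_scaleDr endo_scaleDl.

Fact endo_scaleAl k f g : k *: (f * g) = (k *: f) * g.
Proof. exact: endoP. Qed.
HB.instance Definition _ := GRing.Lmodule_isLalgebra.Build K (endo V) endo_scaleAl.
Fact endo_scaleAr k f g : k *: (f * g) = f * (k *: g).
Proof. by apply: endoP => v /=; rewrite linearZ. Qed.
HB.instance Definition _ := GRing.Lalgebra_isAlgebra.Build K (endo V) endo_scaleAr.

End EndoAlg.

Section Weyl.
Variables (K : fieldType) (n : nat).
Local Notation poly := {mpoly K[n]}.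

Fact mulop_subproof (a : poly) : linear (fun f : poly => a * f).
Proof. by move=> k f g; rewrite mulrDr scalerAr. Qed.
Definition mulop (a : poly) : endo poly := Endo (mulop_subproof a).
Definition derivop (i : 'I_n) : endo poly := Endo (@mderiv_is_linear n K i).

Inductive diffop : endo poly -> Prop :=
  | diffop_mul a : diffop (mulop a)
  | diffop_deriv i : diffop (derivop i)
  | diffop_add f g : diffop f -> diffop g -> diffop (f + g)
  | diffop_comp f g : diffop f -> diffop g -> diffop (f * g).

Definition diffop_pred : {pred endo poly} := fun f => `[< diffop f >].

Fact diffop_closed : subalg_closed diffop_pred.
Proof.
have d1 k : diffop k%:A.
  have -> : k%:A = mulop k%:MP by apply: endoP => v /=; rewrite mul_mpolyC.
  exact: diffop_mul.
split=> [|k f g /asboolP df /asboolP dg|f g /asboolP df /asboolP dg];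
  apply/asboolP.
- by rewrite -[1]scale1r.
- by apply: diffop_add => //; rewrite -mulr_algl; apply: diffop_comp.
- exact: diffop_comp.
Qed.
HB.instance Definition _ := GRing.isSubalgClosed.Build K (endo poly)
  diffop_pred diffop_closed.

(* The ring of differential operators with polynomial coefficients in n
   variables: the subalgebra of End_K K[x_1, ..., x_n] generated by the
   multiplication operators and the partial derivatives. *)
Record weyl : Type := Weyl { weyl_op :> endo poly; _ : weyl_op \in diffop_pred }.
HB.instance Definition _ := [isSub for weyl_op].
HB.instance Definition _ := [Choice of weyl by <:].
HB.instance Definition _ := [SubChoice_isSubAlgebra of weyl by <:].

Definition weyl_x (i : 'I_n) : weyl :=
  Weyl (asboolT (diffop_mul 'X_i)).
Definition weyl_d (i : 'I_n) : weyl :=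
  Weyl (asboolT (diffop_deriv i)).

Lemma weylP (a b : weyl) : (forall f : poly, a f = b f) -> a = b.
Proof. by move=> h; apply/val_inj/endoP. Qed.

Lemma weyl_xC i j : weyl_x i * weyl_x j = weyl_x j * weyl_x i.
Proof. by apply: weylP => f /=; rewrite mulrCA. Qed.

Lemma weyl_dC i j : weyl_d i * weyl_d j = weyl_d j * weyl_d i.
Proof. by apply: weylP => f /=; rewrite mderiv_comm. Qed.

Lemma weyl_dx i j :
  weyl_d i * weyl_x j = weyl_x j * weyl_d i + (i == j)%:R.
Proof.
apply: weylP => f /=; rewrite mderivM mderivX mnm1E [j == i]eq_sym addrC.
have [->|ij] := eqVneq i j; last first.
  by rewrite scale0r mul0r addr0.
rewrite (_ : (U_(j) - U_(j))%MM = 0%MM); last first.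
  by apply/mnmP=> k; rewrite mnmBE mnm0E subnn.
by rewrite mpolyX0 scale1r mul1r.
Qed.
End Weyl.

Section MxLieMorphism.
Variables (K : comNzRingType) (A : algType K) (n : nat).

(* The linear map 'M[K]_n -> A sending E_{i,j} to M i j. *)
Definition mxlin (M : 'M[A]_n) (B : 'M[K]_n) : A :=
  \sum_i \sum_j B i j *: M i j.

Fact mxlin_linear M : linear (mxlin M).
Proof.
move=> k B C; rewrite /mxlin scaler_sumr -big_split; apply: eq_bigr => i _ /=.
rewrite scaler_sumr -big_split; apply: eq_bigr => j _ /=.
by rewrite !mxE scalerDl scalerA.
Qed.

Lemma mxlin_delta M i j : mxlin M (delta_mx i j) = M i j.
Proof.
rewrite /mxlin (bigD1 i) //= (bigD1 j) //= mxE !eqxx scale1r.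
rewrite !big1 ?addr0 // => k /negPf ki; last first.
  by rewrite mxE ki andbF scale0r.
by apply: big1 => l _; rewrite mxE ki scale0r.
Qed.

Lemma mxlinE M B : mxlin M B = \sum_x B x.1 x.2 *: M x.1 x.2.
Proof. exact: pair_bigA. Qed.

Lemma mxlin_comm (M N : 'M[A]_n) (B C : 'M[K]_n) :
  mxlin M B * mxlin N C - mxlin N C * mxlin M B =
  \sum_x \sum_y (B x.1 x.2 * C y.1 y.2) *:
     (M x.1 x.2 * N y.1 y.2 - N y.1 y.2 * M x.1 x.2).
Proof.
rewrite !mxlinE mulr_suml [X in _ - X]mulr_sumr -sumrB.
apply: eq_bigr => x _; rewrite mulr_sumr mulr_suml -sumrB.
apply: eq_bigr => y _; rewrite -!scalerAl -!scalerAr !scalerA.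
by rewrite scalerBr [C _ _ * _]mulrC.
Qed.

Lemma mxlin_mulmx (M : 'M[A]_n) (B C : 'M[K]_n) :
  mxlin M (B *m C) =
  \sum_x \sum_y (B x.1 x.2 * C y.1 y.2) *: ((x.2 == y.1)%:R *: M x.1 y.2).
Proof.
pose F (a b : 'I_n) (y : 'I_n * 'I_n) :=
  (B a b * C y.1 y.2) *: ((b == y.1)%:R *: M a y.2).
rewrite -(pair_bigA _ (fun a b => \sum_y F a b y)); apply: eq_bigr => a _ /=.
transitivity (\sum_d \sum_b (B a b * C b d) *: M a d).
  by apply: eq_bigr => d _; rewrite mxE scaler_suml.
rewrite exchange_big; apply: eq_bigr => b _ /=.
rewrite -(pair_bigA _ (fun c d => F a b (c, d))) [RHS](bigD1 b) //= [X in _ + X]big1 ?addr0.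
  by apply: eq_bigr => d _; rewrite /F /= eqxx scale1r.
move=> c /negPf cb; apply: big1 => d _.
by rewrite /F /= eq_sym cb scale0r scaler0.
Qed.

Lemma mxlin_morphism (M : 'M[A]_n) :
  (forall a b c d, M a b * M c d - M c d * M a b =
     (b == c)%:R *: M a d - (d == a)%:R *: M c b) ->
  lie_morphism (mxlin M).
Proof.
move=> hM; split=> [|B C]; first exact: mxlin_linear.
rewrite mxlin_comm.
have -> : mxlin M (lie B C) = mxlin M (B *m C) - mxlin M (C *m B).
  by rewrite -[- _]scaleN1r addrC -mxlin_linear scaleN1r addrC.
rewrite !mxlin_mulmx [X in _ - X]exchange_big -sumrB; apply: eq_bigr => x _ /=.
rewrite -sumrB; apply: eq_bigr => y _.
by rewrite hM scalerBr [C _ _ * _]mulrC.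
Qed.

End MxLieMorphism.

(* The oscillator construction: Heisenberg pairs give a representation of gl_n. *)
Section Oscillator.
Variables (K : comNzRingType) (A : algType K) (m n : nat).
Variables (z w : 'M[A]_(m, n)) (eps : 'I_n -> K).
Hypothesis zz : forall s a t b, z s a * z t b = z t b * z s a.
Hypothesis ww : forall s a t b, w s a * w t b = w t b * w s a.
Hypothesis wz : forall s b t c,
  w s b * z t c = z t c * w s b + (((s == t) && (b == c))%:R * eps b)%:A.

Let Z a b := \sum_s z s a * w s b.

Lemma oscillator_comm a b c d :
  Z a b * Z c d - Z c d * Z a b =
  (b == c)%:R *: (eps b *: Z a d) - (d == a)%:R *: (eps d *: Z c b).
Proof.
have one s t : z s a * w s b * (z t c * w t d) - z t c * w t d * (z s a * w s b)
  = (((s == t) && (b == c))%:R * eps b) *: (z s a * w t d)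
    - (((t == s) && (d == a))%:R * eps d) *: (z t c * w s b).
  rewrite -[z s a * w s b * _]mulrA [w s b * _]mulrA wz.
  rewrite -[z t c * w t d * _]mulrA [w t d * (_ * _)]mulrA wz.
  rewrite !mulrDl !mulrDr !mulr_algl -!scalerAr opprD addrACA -[RHS]add0r.
  congr (_ + _); rewrite -![_ * w _ _ * w _ _]mulrA ww !mulrA (zz s a).
  by rewrite subrr.
rewrite /Z mulr_suml [X in _ - X]mulr_sumr -sumrB.
under eq_bigr => s _.
  rewrite mulr_sumr mulr_suml -sumrB.
  under eq_bigr => t _ do rewrite one.
  rewrite (bigD1 s) //= eqxx big1 ?addr0; last first.
    by move=> t /negPf ts; rewrite eq_sym ts !mul0r !scale0r subrr.
  over.
by rewrite sumrB -!scaler_sumr !scalerA.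
Qed.

Lemma comm_add_scalar (u v : A) (k l : K) :
  (u + k%:A) * (v + l%:A) - (v + l%:A) * (u + k%:A) = u * v - v * u.
Proof.
rewrite !mulrDl !mulrDr !mulr_algl !mulr_algr !scalerA [l * k]mulrC.
rewrite [X in _ - X]addrACA opprD addrACA subrr addr0.
by rewrite opprD addrACA subrr addr0.
Qed.

Lemma oscillator_morphism (e : 'I_n -> K) (k : K) :
  (forall a, eps a * e a ^+ 2 = 1) ->
  lie_morphism (mxlin (\matrix_(a, b)
     ((e a * e b) *: (Z a b + (k * eps a *+ (a == b))%:A)))).
Proof.
move=> e2; apply: mxlin_morphism => a b c d; rewrite !mxE.
rewrite -!scalerAl -!scalerAr !scalerA [e c * e d * _]mulrC -scalerBr.
rewrite comm_add_scalar oscillator_comm scalerBr !scalerDr opprD addrACA !scalerA.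
rewrite -[LHS]addr0; congr (_ + _ + _).
- case: eqVneq => [<-|_]; last by rewrite mul0r mulr0 !mul0r !scale0r.
  congr (_ *: _); rewrite !mulr1n !mul1r.
  by rewrite [LHS](_ : _ = e a * e d * (eps b * e b ^+ 2)); [rewrite e2 mulr1 | ring].
- case: eqVneq => [<-|_]; last by rewrite mul0r mulr0 !mul0r !scale0r.
  congr (- (_ *: _)); rewrite !mulr1n !mul1r.
  by rewrite [LHS](_ : _ = e c * e b * (eps d * e d ^+ 2)); [rewrite e2 mulr1 | ring].
rewrite [d == a]eq_sym [c == b]eq_sym.
case: (eqVneq b c) => [<-|_]; case: (eqVneq a d) => [<-|_];
  rewrite ?mulr0n ?mul0r ?mulr0 ?scale0r ?oppr0 ?addr0 ?scaler0 //.
apply/esym/eqP; rewrite subr_eq0; apply/eqP; congr (_ *: _); rewrite !mul1r !mulr1n.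
transitivity (k * (eps a * e a ^+ 2)); first by ring.
by rewrite e2 -(e2 b); ring.
Qed.

End Oscillator.

Section Weil.
Variables (C : numClosedFieldType) (m p q : nat).

(* PD(V) for V = Mat(m, p; C) + Mat(m, q; C); the coordinates x_{s,i} come
   first, then the y_{s,i}. *)
Definition PD : Type := weyl C (m * p + m * q).
HB.instance Definition _ := GRing.Algebra.on PD.

Definition idxX (s : 'I_m) (i : 'I_p) := lshift (m * q) (mxvec_index s i).
Definition idxY (s : 'I_m) (i : 'I_q) := rshift (m * p) (mxvec_index s i).

Definition matX : 'M[PD]_(m, p) := \matrix_(s, i) weyl_x C (idxX s i).
Definition matDX : 'M[PD]_(m, p) := \matrix_(s, i) weyl_d C (idxX s i).
Definition matY : 'M[PD]_(m, q) := \matrix_(s, i) weyl_x C (idxY s i).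
Definition matDY : 'M[PD]_(m, q) := \matrix_(s, i) weyl_d C (idxY s i).

Definition matP : 'M[PD]_(m, p + q) := row_mx matX matDY.
Definition matQ : 'M[PD]_(m, p + q) := row_mx matDX matY.

Definition omegaX : 'M[PD]_m := \matrix_(s, t)
  (\sum_i matX s i * matDX t i + (p%:R / 2 *+ (s == t))%:A).
Definition omegaY : 'M[PD]_m := \matrix_(s, t)
  (\sum_i matY s i * matDY t i + (q%:R / 2 *+ (s == t))%:A).
Definition omega_g_gen (x : 'M[C]_m * 'M[C]_m) : PD :=
  mxlin omegaX x.1 + mxlin omegaY x.2.

Definition omegaB : 'M[PD]_(p + q) := block_mx
  (\matrix_(i, j) (\sum_s matX s i * matDX s j + (m%:R / 2 *+ (i == j))%:A))
  (\matrix_(i, j) ('i *: \sum_s matX s i * matY s j))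
  (\matrix_(j, i) ('i *: \sum_s matDX s i * matDY s j))
  (\matrix_(i, j) (- (\sum_s matY s j * matDY s i) - (m%:R / 2 *+ (i == j))%:A)).
Definition omega_m_gen (B : 'M[C]_(p + q)) : PD := mxlin omegaB B.

Lemma idxX_eq s i t j : (idxX s i == idxX t j) = ((s == t) && (i == j)).
Proof. by rewrite (inj_eq (@lshift_inj _ _)) /mxvec_index
   (inj_eq (@cast_ord_inj _ _ _)) (inj_eq enum_rank_inj). Qed.
Lemma idxY_eq s i t j : (idxY s i == idxY t j) = ((s == t) && (i == j)).
Proof. by rewrite (inj_eq (@rshift_inj _ _)) /mxvec_index
   (inj_eq (@cast_ord_inj _ _ _)) (inj_eq enum_rank_inj). Qed.
Lemma idxXY s i t j : (idxX s i == idxY t j) = false.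
Proof. exact: eq_lrshift. Qed.
Lemma idxYX s i t j : (idxY s i == idxX t j) = false.
Proof. exact: eq_rlshift. Qed.

Lemma weyl_dxC (i j : 'I_(m * p + m * q)) :
  i != j -> weyl_d C i * weyl_x C j = weyl_x C j * weyl_d C i.
Proof. by move=> /negPf ij; rewrite weyl_dx ij addr0. Qed.

Lemma omegaX_morphism : lie_morphism (mxlin omegaX).
Proof.
have -> : omegaX = \matrix_(a, b) ((1 * 1) *:
    (\sum_s matX^T s a * matDX^T s b + (p%:R / 2 * 1 *+ (a == b))%:A)).
  apply/matrixP=> a b; rewrite !mxE mulr1 mulr1 scale1r.
  by congr (_ + _); apply: eq_bigr => s _; rewrite !mxE.
apply: (@oscillator_morphism _ _ _ _ matX^T matDX^T (fun _ => 1) _ _ _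
  (fun _ => 1)) => [s a t b|s a t b|s b t c|a]; rewrite ?mxE.
- exact: weyl_xC.
- exact: weyl_dC.
- by rewrite weyl_dx idxX_eq mulr1 scaler_nat [(_ == _) && _]andbC.
- by rewrite expr1n mulr1.
Qed.

Lemma omegaY_morphism : lie_morphism (mxlin omegaY).
Proof.
have -> : omegaY = \matrix_(a, b) ((1 * 1) *:
    (\sum_s matY^T s a * matDY^T s b + (q%:R / 2 * 1 *+ (a == b))%:A)).
  apply/matrixP=> a b; rewrite !mxE mulr1 mulr1 scale1r.
  by congr (_ + _); apply: eq_bigr => s _; rewrite !mxE.
apply: (@oscillator_morphism _ _ _ _ matY^T matDY^T (fun _ => 1) _ _ _
  (fun _ => 1)) => [s a t b|s a t b|s b t c|a]; rewrite ?mxE.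
- exact: weyl_xC.
- exact: weyl_dC.
- by rewrite weyl_dx idxY_eq mulr1 scaler_nat [(_ == _) && _]andbC.
- by rewrite expr1n mulr1.
Qed.

Lemma omegaXY_comm s t u v : GRing.comm (omegaX s t) (omegaY u v).
Proof.
have comm_alg k (a : PD) : GRing.comm a k%:A.
  by rewrite /GRing.comm mulr_algl mulr_algr.
rewrite !mxE; apply: commrD; last exact: comm_alg.
apply: commr_sum => j _; apply/commr_sym.
apply: commrD; last exact: comm_alg.
apply: commr_sum => i _; rewrite !mxE; apply: commrM; apply/commr_sym;
  apply: commrM; rewrite /GRing.comm; try exact: weyl_xC; try exact: weyl_dC;
  by rewrite weyl_dxC ?idxXY ?idxYX.
Qed.

Lemma omega_g_gen_morphism : lie_morphism omega_g_gen.
Proof.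
have [lX hX] := omegaX_morphism; have [lY hY] := omegaY_morphism.
have XY A B : mxlin omegaX A * mxlin omegaY B = mxlin omegaY B * mxlin omegaX A.
  apply/eqP; rewrite -subr_eq0 mxlin_comm big1 // => x _.
  by rewrite big1 // => y _; rewrite omegaXY_comm subrr scaler0.
split=> [k x y|x y]; rewrite /omega_g_gen /=.
  by rewrite lX lY scalerDr addrACA.
rewrite hX hY !mulrDl !mulrDr (XY x.1) (XY y.1).
rewrite [X in _ = X - _]addrACA [in RHS]opprD [RHS]addrACA.
rewrite [in RHS]opprD [X in _ = X + _]addrACA subrr addr0.
by rewrite [in RHS]opprD [X in _ = _ + X]addrACA subrr add0r.
Qed.

Let eps (a : 'I_(p + q)) : C := if split a is inl _ then 1 else -1.
Let e (a : 'I_(p + q)) : C := if split a is inl _ then 1 else 'i.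

Lemma omegaBE : omegaB = \matrix_(a, b) ((e a * e b) *:
  (\sum_s matP s a * matQ s b + (m%:R / 2 * eps a *+ (a == b))%:A)).
Proof.
have splitl i : split (lshift q i) = inl i := unsplitK (inl i : 'I_p + 'I_q).
have splitr i : split (rshift p i) = inr i := unsplitK (inr i : 'I_p + 'I_q).
apply/matrixP=> a b; rewrite [RHS]mxE /e /eps.
case: (split_ordP a) => i ->; case: (split_ordP b) => j ->;
  rewrite ?splitl ?splitr.
- rewrite block_mxEul mxE mulr1 mulr1 scale1r (inj_eq (@lshift_inj _ _)).
  by congr (_ + _); apply: eq_bigr => s _; rewrite !row_mxEl.
- rewrite block_mxEur mxE mul1r eq_lrshift scale0r addr0; congr (_ *: _).
  by apply: eq_bigr => s _; rewrite row_mxEl row_mxEr.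
- rewrite block_mxEdl mxE mulr1 eq_rlshift scale0r addr0; congr (_ *: _).
  by apply: eq_bigr => s _; rewrite row_mxEl row_mxEr !mxE weyl_dC.
rewrite block_mxEdr mxE -expr2 sqrCi (inj_eq (@rshift_inj _ _)) scaleN1r opprD.
under [in RHS]eq_bigr => s _.
  rewrite !row_mxEr !mxE weyl_dx idxY_eq eqxx /=; over.
rewrite big_split /= sumr_const card_ord opprD -addrA; congr (- _ + _).
  by apply: eq_bigr => s _; rewrite !mxE.
case: (i == j); rewrite ?mulr0n ?mul0rn ?scale0r ?oppr0 ?subr0 //; last first.
  by rewrite addr0.
rewrite !mulr1n mulrN1 scaleNr opprK -scaler_nat -!scaleNr -scalerDl.
by congr (_ *: _); field.
Qed.

Lemma omega_m_gen_morphism : lie_morphism omega_m_gen.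
Proof.
have splitl i : split (lshift q i) = inl i := unsplitK (inl i : 'I_p + 'I_q).
have splitr i : split (rshift p i) = inr i := unsplitK (inr i : 'I_p + 'I_q).
rewrite /omega_m_gen omegaBE.
apply: oscillator_morphism => [s a t b|s a t b|s b t c|a]; last first.
- rewrite /eps /e; case: split => _; first by rewrite expr1n mulr1.
  by rewrite sqrCi mulrNN mulr1.
- rewrite /eps; case: (split_ordP b) => j ->; case: (split_ordP c) => k ->;
    rewrite ?splitl ?splitr ?row_mxEl ?row_mxEr !mxE.
  + by rewrite weyl_dx idxX_eq (inj_eq (@lshift_inj _ _)) mulr1 scaler_nat.
  + by rewrite weyl_dC eq_lrshift andbF mul0r scale0r addr0.
  + by rewrite weyl_xC eq_rlshift andbF mul0r scale0r addr0.
  rewrite weyl_dx idxY_eq (inj_eq (@rshift_inj _ _)) mulrN1 scaleNr scaler_nat.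
  by rewrite [t == s]eq_sym [k == j]eq_sym addrK.
- case: (split_ordP a) => i ->; case: (split_ordP b) => j ->;
    rewrite ?row_mxEl ?row_mxEr !mxE;
  by [exact: weyl_xC | exact: weyl_dC | rewrite weyl_dxC ?idxXY ?idxYX].
case: (split_ordP a) => i ->; case: (split_ordP b) => j ->;
    rewrite ?row_mxEl ?row_mxEr !mxE;
  by [exact: weyl_xC | exact: weyl_dC | rewrite weyl_dxC ?idxXY ?idxYX].
Qed.

Definition omega_g : uea ('M[C]_m * 'M[C]_m)%type -> PD := uea_lift omega_g_gen.
Definition omega_m : uea 'M[C]_(p + q) -> PD := uea_lift omega_m_gen.

HB.instance Definition _ := GRing.isLinear.Build C
  (uea ('M[C]_m * 'M[C]_m)%type) PD *:%R omega_g
  (uea_lift_linear omega_g_gen_morphism).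
HB.instance Definition _ := GRing.isMonoidMorphism.Build
  (uea ('M[C]_m * 'M[C]_m)%type) PD omega_g
  (uea_lift_monoid omega_g_gen_morphism).
HB.instance Definition _ := GRing.isLinear.Build C
  (uea 'M[C]_(p + q)) PD *:%R omega_m (uea_lift_linear omega_m_gen_morphism).
HB.instance Definition _ := GRing.isMonoidMorphism.Build
  (uea 'M[C]_(p + q)) PD omega_m (uea_lift_monoid omega_m_gen_morphism).

Lemma omega_gX s t : omega_g (uea_gen (delta_mx s t, 0)) = omegaX s t.
Proof.
rewrite [LHS](uea_lift_gen omega_g_gen_morphism) /omega_g_gen mxlin_delta.
by rewrite /mxlin big1 ?addr0 // => i _; rewrite big1 // => j _;
  rewrite mxE scale0r.
Qed.

Lemma omega_gY s t : omega_g (uea_gen (0, delta_mx s t)) = omegaY s t.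
Proof.
rewrite [LHS](uea_lift_gen omega_g_gen_morphism) /omega_g_gen mxlin_delta.
by rewrite /mxlin big1 ?add0r // => i _; rewrite big1 // => j _;
  rewrite mxE scale0r.
Qed.

Lemma omega_mB i j : omega_m (uea_gen (delta_mx i j)) = omegaB i j.
Proof.
by rewrite [LHS](uea_lift_gen omega_m_gen_morphism) /omega_m_gen mxlin_delta.
Qed.

End Weil.

Section Invariants.
Variable C : fieldType.

(* K = GL_m is embedded in GL_m x GL_m by k |-> (k, k^{-T}), the embedding
   whose differential has image {(A, - A^T)}. *)
Definition Ad_K m (k : 'M[C]_m) (x : 'M[C]_m * 'M[C]_m) : 'M[C]_m * 'M[C]_m :=
  (k *m x.1 *m invmx k, (invmx k)^T *m x.2 *m k^T).

Definition Ad_H p q (h1 : 'M[C]_p) (h2 : 'M[C]_q) (B : 'M[C]_(p + q)) :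
    'M[C]_(p + q) :=
  let h := block_mx h1 0 0 h2 in h *m B *m invmx h.

Lemma conj_linear n (k l : 'M[C]_n) : linear (fun x => k *m x *m l).
Proof.
by move=> a x y; rewrite mulmxDr mulmxDl -scalemxAr -scalemxAl.
Qed.

Lemma conj_lie n (k l : 'M[C]_n) : l *m k = 1%:M ->
  {morph (fun x => k *m x *m l) : x y / lie x y}.
Proof.
move=> lk x y.
have mul u v : (k *m u *m l) *m (k *m v *m l) = k *m (u *m v) *m l.
  by rewrite -!mulmxA [l *m (k *m _)]mulmxA lk mul1mx.
by rewrite /lie /= /gl_lie !mul mulmxBr mulmxBl.
Qed.

Lemma lie_morphism_comp (L : lieType C) (phi : L -> L) :
  linear phi -> {morph phi : x y / lie x y} -> lie_morphism (@uea_gen _ L \o phi).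
Proof.
move=> phiL phi_lie; split=> [a x y|x y] /=.
  by rewrite phiL linearP.
by rewrite phi_lie (uea_gen_morphism L).2.
Qed.

Lemma Ad_K_morphism m (k : 'M[C]_m) : k \in unitmx ->
  lie_morphism (@uea_gen _ ('M[C]_m * 'M[C]_m)%type \o Ad_K k).
Proof.
move=> ku; apply: lie_morphism_comp => [a x y|x y].
  by rewrite /Ad_K /= !conj_linear.
congr (_, _); apply: conj_lie; first exact: mulVmx.
by rewrite -trmx_mul mulVmx // trmx1.
Qed.

Lemma Ad_H_morphism p q (h1 : 'M[C]_p) (h2 : 'M[C]_q) :
  h1 \in unitmx -> h2 \in unitmx ->
  lie_morphism (@uea_gen _ 'M[C]_(p + q) \o Ad_H h1 h2).
Proof.
move=> u1 u2; apply: lie_morphism_comp; first exact: conj_linear.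
apply: conj_lie; apply: mulVmx.
by rewrite unitmxE det_ublock unitrM -!unitmxE u1.
Qed.

(* The adjoint action on the Lie algebra extends uniquely to U by algebra
   automorphisms. *)
Definition K_invariant m (u : uea ('M[C]_m * 'M[C]_m)%type) :=
  forall k : 'M[C]_m, k \in unitmx -> uea_lift (@uea_gen _ _ \o Ad_K k) u = u.

Definition H_invariant p q (u : uea 'M[C]_(p + q)) :=
  forall (h1 : 'M[C]_p) (h2 : 'M[C]_q), h1 \in unitmx -> h2 \in unitmx ->
    uea_lift (@uea_gen _ _ \o Ad_H h1 h2) u = u.

End Invariants.

(* The d-element subsets S of {0, ..., n-1}, with elements
   S(0) < ... < S(d-1) given by [elt S]. *)
Definition dset (n d : nat) : Type := {S : {set 'I_n} | #|S| == d}.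
HB.instance Definition _ n d := Finite.on (dset n d).

Definition elt n d (S : dset n d) (k : 'I_d) : 'I_n :=
  enum_val (cast_ord (esym (eqP (valP S))) k).

Lemma elt_increasing n d (S : dset n d) (j k : 'I_d) :
  (j < k)%N -> (elt S j < elt S k)%N.
Proof.
move=> jk; rewrite /elt; set j' := cast_ord _ j; set k' := cast_ord _ k.
have {}jk : (j' < k')%N by [].
have srt : sorted ltn (map val (enum (val S))).
  rewrite [enum _]/(enum_mem _) -enumT.
  apply: (subseq_sorted ltn_trans (s2 := map val (enum 'I_n))).
    exact/map_subseq/filter_subseq.
  by rewrite val_enum_ord iota_ltn_sorted.
have x0 : 'I_n := enum_val j'.
rewrite !(enum_val_nth x0).
have sz (i : 'I_#|val S|) :
    (i : nat) \in [pred k | (k < size (map val (enum (val S))))%N].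
  by rewrite inE size_map -cardE.
have := sorted_ltn_nth ltn_trans 0 srt _ _ (sz j') (sz k') jk.
by rewrite !(nth_map x0) // -cardE.
Qed.

Definition splits n d l l' (S : dset n d) (S1 : dset n l) (S2 : dset n l') :=
  [disjoint val S1 & val S2] && (val S1 :|: val S2 == val S).

(* The number of pairs of positions j < k with s_j > s_k. *)
Definition inversions (s : seq nat) : nat :=
  #|[set x : 'I_(size s) * 'I_(size s) |
      (x.1 < x.2)%N && (nth 0 s x.2 < nth 0 s x.1)%N]|.

Definition set_inv n l l' (S1 : dset n l) (S2 : dset n l') : nat :=
  inversions ([seq val i | i <- enum (val S1)] ++ [seq val i | i <- enum (val S2)]).

(* For matrices with commuting entries. *)
Definition minor (R : nzRingType) a b d (M : 'M[R]_(a, b)) (S : dset a d)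
    (T : dset b d) : R :=
  \det (mxsub (elt S) (elt T) M).

(* \prod is taken in the order k = 0, 1, ..., from left to right. *)
Definition col_det (C : fieldType) (U : algType C) m l (A : 'M[U]_m)
    (S T : dset m l) (u : 'I_l -> C) : U :=
  \sum_(s : 'S_l) (-1) ^+ s *
    \prod_(k < l) (A (elt S (s k)) (elt T k)
                   + (u k *+ (elt S (s k) == elt T k))%:A).

Definition Ipq (C : fieldType) p q : 'M[C]_(p + q) := block_mx 1%:M 0 0 (- 1%:M).

Definition Det_pq (C : fieldType) (U : algType C) p q d (B : 'M[U]_(p + q))
    (I J : dset (p + q) d) (u : 'I_d -> C) : U :=
  let eps := - Ipq C p q in
  (d`!%:R^-1 : C) *: \sum_(s : 'S_d) \sum_(t : 'S_d)
    (-1) ^+ s * (-1) ^+ t *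
    \prod_(k < d) (B (elt I (s k)) (elt J (t k))
                   - (u k * eps (elt I (s k)) (elt J (t k)))%:A).

Section Elements.
Variables (C : numClosedFieldType) (m p q d : nat).

Definition Ug := uea ('M[C]_m * 'M[C]_m)%type.
HB.instance Definition _ := GRing.Algebra.on Ug.

Definition EX : 'M[Ug]_m := \matrix_(s, t) uea_gen (delta_mx s t, 0).
Definition EY : 'M[Ug]_m := \matrix_(s, t) uea_gen (0, delta_mx s t).

(* Indices k start at 0, so these are (l-1-p/2, ..., -p/2) and
   (-(l-1)+q/2, ..., q/2). *)
Definition alpha l (k : 'I_l) : C := (l - k.+1)%:R - p%:R / 2.
Definition beta l (k : 'I_l) : C := - (l - k.+1)%:R + q%:R / 2.

Definition X_elt : Ug :=
  \sum_(S : dset m d) \sum_(l < d.+1)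
  \sum_(S1 : dset m l) \sum_(S2 : dset m (d - l) | splits S S1 S2)
  \sum_(T1 : dset m l) \sum_(T2 : dset m (d - l) | splits S T1 T2)
    (-1) ^+ (set_inv S1 S2 + set_inv T1 T2)
    * col_det EX S1 T1 (@alpha l) * col_det EY^T S2 T2 (@beta (d - l)).

Definition Um := uea 'M[C]_(p + q).
HB.instance Definition _ := GRing.Algebra.on Um.

Definition matB' : 'M[Um]_(p + q) := \matrix_(i, j) uea_gen (delta_mx i j).
Definition matD : 'M[C]_(p + q) := block_mx 1%:M 0 0 (- 'i)%:M.
Definition matB : 'M[Um]_(p + q) :=
  map_mx (in_alg Um) matD *m matB' *m map_mx (in_alg Um) matD.

Definition C_elt : Um :=
  \sum_(J : dset (p + q) d)
    Det_pq (matB - map_mx (in_alg Um) ((m%:R / 2) *: Ipq C p q)) J J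
      (fun k : 'I_d => (d - k.+1)%:R).

End Elements.

(* Main.v *)
Require Import Defs.
From HB Require Import structures.
From mathcomp Require Import all_boot all_order fingroup perm all_algebra.
From mathcomp Require Import boolp reals complex mpoly.

Import Order.TTheory GRing.Theory Num.Theory.
Local Open Scope ring_scope.
Local Open Scope complex_scope.

Set Implicit Arguments.
Unset Strict Implicit.
Unset Printing Implicit Defensive.

(** Write alt_trace M, for d matrices M_1, ..., M_d over a noncommutative
    algebra, for the sum over all sequences s of d indices and all permutations
    r of sgn(r) M_1(s_1, s_r(1)) ... M_d(s_d, s_r(d)): the trace of the ordered
    tensor product of the M_k composed with the antisymmetrizer. The proof
    rests on the fact that both elements of the theorem are combinations of
    such traces: C_d is alt_trace(C_factor) / d! ([C_eltE]), directly from the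
    definition, and X_d is the sum over l of alt_trace(X_factor l) divided by
    l! (d - l)! ([X_eltE]). In the second case the sums over complementary
    subsets are sums over permutations ([laplace_split]) provided that the
    column determinants are antisymmetric in their columns
    ([column_det_perm]), which holds thanks to the commutation relations of
    gl_m and the unit steps of the shifts alpha and beta.

    The trace does not change when all M_k are conjugated by the same scalar
    matrix ([alt_trace_conjmx]), and this is how K acts on the factors of X_d
    and H on those of C_d. This proves the invariance of X_d and of C_d.

    Under omega, each factor becomes a contraction of P with Q plus a
    diagonal shift. The shifts are those of the Capelli identity: moving the
    entries of Q to the right of those of P produces commutators that they
    cancel exactly, so that a trace becomes a sum of products of a minor of P
    with a minor of Q ([normal_order]). For C_d the contraction is over the row
    indices of P and Q, and the result is the middle term of the theorem. For
    X_d the contraction is over their column indices, the first l factors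
    contracting the columns of X and the other d - l those of Y; here the
    Capelli identity is needed for indices of two colours, with commutators of
    opposite signs. The traces for the different l yield the sequences of column
    indices which begin with l columns of X and end with d - l columns of Y.
    Since the product of the two minors is symmetric in the sequence, the
    weights 1 / (l! (d - l)!) make their sum the average over all sequences
    ([sum_by_color]), which is again the middle term. *)

(** * Subsets and injective sequences *)

Lemma elt_inj n d (S : dset n d) : injective (elt S).
Proof. by move=> j k /enum_val_inj /cast_ord_inj. Qed.

Lemma elt_imset n d (S : dset n d) : elt S @: [set: 'I_d] = val S.
Proof.
apply/eqP; rewrite eqEcard card_imset; last exact: elt_inj.
rewrite cardsT card_ord (eqP (valP S)) leqnn andbT.
by apply/subsetP=> _ /imsetP[k _ ->]; apply: enum_valP.
Qed.

(** The arrangements of the elements of [S]: every injective sequence is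
    [elt_perm S r] for exactly one pair [(S, r)]. They are finite functions so
    that one can sum over all sequences of indices. *)
Definition elt_perm n d (S : dset n d) (r : 'S_d) : {ffun 'I_d -> 'I_n} :=
  [ffun k => elt S (r k)].

Lemma elt_permE n d (S : dset n d) (r : 'S_d) :
  elt_perm S r =1 (fun k => elt S (r k)).
Proof. by move=> k; rewrite ffunE. Qed.

Lemma elt_perm_inj n d (S : dset n d) (r : 'S_d) : injective (elt_perm S r).
Proof. by move=> j k; rewrite !ffunE => /elt_inj /perm_inj. Qed.

Lemma elt_perm_imset n d (S : dset n d) (r : 'S_d) :
  elt_perm S r @: [set: 'I_d] = val S.
Proof.
apply/eqP; rewrite eqEcard card_imset; last exact: elt_perm_inj.
rewrite cardsT card_ord (eqP (valP S)) leqnn andbT.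
by apply/subsetP=> _ /imsetP[k _ ->]; rewrite ffunE; apply: enum_valP.
Qed.

(** An injective sequence is the same thing as a set together with an ordering
    of it; this is how every sum over subsets below is traded for a sum over
    sequences. *)
Lemma sum_inj_seqs (V : nmodType) n d (f : {ffun 'I_d -> 'I_n} -> V) :
  \sum_(s : {ffun 'I_d -> 'I_n} | injectiveb s) f s =
  \sum_(S : dset n d) \sum_(r : 'S_d) f (elt_perm S r).
Proof.
rewrite pair_bigA /=; pose h (x : dset n d * 'S_d) := elt_perm x.1 x.2.
have h_inj : injective h.
  move=> [S1 r1] [S2 r2] /= e.
  have eS : S1 = S2.
    apply: val_inj; rewrite -(elt_perm_imset S1 r1) -(elt_perm_imset S2 r2).
    by rewrite -/(h (S1, r1)) e.
  subst S2; congr (_, _); apply/permP=> k; apply: (@elt_inj _ _ S1).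
  by move/ffunP/(_ k): e; rewrite !ffunE.
transitivity (\sum_(x in [set: dset n d * 'S_d]) f (h x)); last first.
  by apply: eq_bigl => x; rewrite in_setT.
rewrite -(big_imset f (in2W h_inj)).
apply: eq_bigl => s; apply/injectiveP/imsetP => [s_inj|[[S r] _ ->]];
  last exact: elt_perm_inj.
have cS : #|s @: [set: 'I_d]| == d by rewrite card_imset // cardsT card_ord.
pose S : dset n d := exist (fun B : {set 'I_n} => #|B| == d) _ cS.
have ex k : exists j, s k == elt S j.
  have : s k \in elt S @: [set: 'I_d] by rewrite elt_imset imset_f.
  by case/imsetP=> j _ ->; exists j.
pose g k := xchoose (ex k).
have gE k : s k = elt S (g k) by apply/eqP/(xchooseP (ex k)).
have g_inj : injective g by move=> j k e; apply: s_inj; rewrite !gE e.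
exists (S, perm g_inj) => //; apply/ffunP=> k.
by rewrite ffunE permE -gE.
Qed.

Lemma sum_seqs_onto (V : nmodType) n d (S : dset n d)
    (f : {ffun 'I_d -> 'I_n} -> V) :
  \sum_(s : {ffun 'I_d -> 'I_n} |
      injectiveb s && (s @: [set: 'I_d] == val S)) f s =
  \sum_(r : 'S_d) f (elt_perm S r).
Proof.
rewrite big_mkcondr sum_inj_seqs (bigD1 S) //= [X in _ + X]big1 ?addr0.
  by apply: eq_bigr => r _; rewrite elt_perm_imset eqxx.
move=> S' /negPf S'S; apply: big1 => r _.
by rewrite elt_perm_imset (inj_eq val_inj) S'S.
Qed.

(** * Signs of sequences and complementary subsets *)

Section Vandermonde.
Variable n : nat.

(** The Vandermonde product of the entries of [s]. Its sign plays the role of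
    (-1) to the number of inversions, and has the advantage that its behaviour
    under permutations and concatenations follows from the Vandermonde
    determinant. *)
Definition vdm d (s : 'I_d -> 'I_n) : int :=
  \prod_(i < d) \prod_(j < d | (i < j)%N) ((s j)%:Z - (s i)%:Z).

Lemma vdmE d (s : 'I_d -> 'I_n) :
  vdm s = \det (Vandermonde d (\row_j (s j)%:Z)).
Proof.
rewrite det_Vandermonde; apply: eq_bigr => i _; apply: eq_bigr => j _.
by rewrite !mxE.
Qed.

Lemma eq_vdm d (s t : 'I_d -> 'I_n) : s =1 t -> vdm s = vdm t.
Proof.
by move=> st; apply: eq_bigr => i _; apply: eq_bigr => j _; rewrite !st.
Qed.

Lemma vdm_perm d (s : 'I_d -> 'I_n) (r : 'S_d) :
  vdm (fun k => s (r k)) = (-1) ^+ r * vdm s.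
Proof.
rewrite !vdmE -det_perm mulrC -[\det (perm_mx r)]det_tr -det_mulmx.
congr (\det _); rewrite tr_perm_mx -col_permE.
by apply/matrixP=> i j; rewrite !mxE.
Qed.

Lemma vdm_neq0 d (s : 'I_d -> 'I_n) : injective s -> vdm s != 0.
Proof.
move=> s_inj; apply/prodf_neq0=> i _; apply/prodf_neq0=> j ij.
rewrite subr_eq0 eqz_nat; apply/eqP=> /val_inj/s_inj e.
by rewrite e ltnn in ij.
Qed.

Definition vsign d (s : 'I_d -> 'I_n) : bool := vdm s < 0.

Lemma vsign_perm d (s : 'I_d -> 'I_n) (r : 'S_d) : injective s ->
  vsign (fun k => s (r k)) = odd_perm r (+) vsign s.
Proof.
move=> /vdm_neq0 s0; rewrite /vsign vdm_perm; case: (odd_perm r).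
  by rewrite mulN1r oppr_lt0 addTb; case: ltgtP s0.
by rewrite mul1r.
Qed.

Lemma vsign_increasing d (s : 'I_d -> 'I_n) :
  (forall j k : 'I_d, (j < k)%N -> (s j < s k)%N) -> vsign s = false.
Proof.
move=> s_incr; apply/negbTE; rewrite -leNgt; apply: prodr_ge0 => i _.
by apply: prodr_ge0 => j /s_incr ij; rewrite subr_ge0 lez_nat ltnW.
Qed.

(** For an arrangement of a set the sign is that of the permutation, since the
    Vandermonde product of an increasing sequence is positive. *)
Lemma vsign_elt_perm d (S : dset n d) (r : 'S_d) :
  vsign (elt_perm S r) = odd_perm r.
Proof.
transitivity (vsign (fun k => elt S (r k))).
  by rewrite /vsign (@eq_vdm _ _ (fun k => elt S (r k))) // => k; rewrite ffunE.
rewrite vsign_perm; last exact: elt_inj.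
by rewrite vsign_increasing ?addbF // => j k; apply: elt_increasing.
Qed.

Definition cat_fun l l' (s : 'I_l -> 'I_n) (t : 'I_l' -> 'I_n) :
    {ffun 'I_(l + l') -> 'I_n} :=
  [ffun k => match split k with inl i => s i | inr j => t j end].

Lemma cat_funl l l' (s : 'I_l -> 'I_n) (t : 'I_l' -> 'I_n) i :
  cat_fun s t (lshift l' i) = s i.
Proof. by rewrite ffunE (unsplitK (inl i : 'I_l + 'I_l')). Qed.

Lemma cat_funr l l' (s : 'I_l -> 'I_n) (t : 'I_l' -> 'I_n) j :
  cat_fun s t (rshift l j) = t j.
Proof. by rewrite ffunE (unsplitK (inr j : 'I_l + 'I_l')). Qed.

Lemma cat_fun_imset l l' (s : 'I_l -> 'I_n) (t : 'I_l' -> 'I_n) :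
  cat_fun s t @: [set: 'I_(l + l')] = s @: [set: 'I_l] :|: t @: [set: 'I_l'].
Proof.
apply/setP=> x; apply/imsetP/setUP => [[k _ ->]|[] /imsetP[k _ ->]].
- by case: (split_ordP k) => i ->;
    [left; rewrite cat_funl imset_f | right; rewrite cat_funr imset_f].
- by exists (lshift l' k); rewrite ?cat_funl.
by exists (rshift l k); rewrite ?cat_funr.
Qed.

Lemma cat_fun_injectiveb l l' (s : 'I_l -> 'I_n) (t : 'I_l' -> 'I_n) :
  injectiveb (cat_fun s t) =
  [&& injectiveb s, injectiveb t
    & [disjoint s @: [set: 'I_l] & t @: [set: 'I_l']]].
Proof.
apply/injectiveP/and3P => [inj|[/injectiveP s_inj /injectiveP t_inj dis]].
  split; [apply/injectiveP=> j k e | apply/injectiveP=> j k e |].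
  - by apply: (@lshift_inj _ l'); apply: inj; rewrite !cat_funl.
  - by apply: (@rshift_inj l _); apply: inj; rewrite !cat_funr.
  rewrite disjoint_subset; apply/subsetP=> _ /imsetP[i _ ->].
  apply/imsetP=> -[j _]; rewrite -(cat_funl s t) -(cat_funr s t) => /inj/eqP.
  by rewrite eq_lrshift.
have st i j : s i == t j = false.
  apply/eqP=> e; have := imset_f s (in_setT i) => /(disjointFr dis).
  by rewrite e imset_f.
move=> j k; case: (split_ordP j) => j' ->; case: (split_ordP k) => k' ->;
  rewrite ?cat_funl ?cat_funr.
- by move/s_inj->.
- by move/eqP; rewrite st.
- by move/esym/eqP; rewrite st.
by move/t_inj->.
Qed.

(** The cross factor of the Vandermonde product of a concatenation; it depends
    on the two blocks only through their entries, not through their order. *)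
Definition vdm2 l l' (s : 'I_l -> 'I_n) (t : 'I_l' -> 'I_n) : int :=
  \prod_(i < l) \prod_(j < l') ((t j)%:Z - (s i)%:Z).

Lemma vdm_cat l l' (s : 'I_l -> 'I_n) (t : 'I_l' -> 'I_n) :
  vdm (cat_fun s t) = vdm s * vdm t * vdm2 s t.
Proof.
rewrite /vdm big_split_ord /= mulrAC; congr (_ * _).
  rewrite -big_split; apply: eq_bigr => i _ /=.
  rewrite big_split_ord /=; congr (_ * _).
    by apply: eq_bigr => j _; rewrite !cat_funl.
  apply: eq_big => j; last by rewrite cat_funl cat_funr.
  by rewrite ltn_addr.
apply: eq_bigr => i _; rewrite big_split_ord /= big_pred0 ?mul1r.
  apply: eq_big => j; last by rewrite !cat_funr.
  by rewrite ltn_add2l.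
by move=> j; apply/negbTE; rewrite -leqNgt ltnW // ltn_addr.
Qed.

Lemma vdm_cat_perm l l' (s : 'I_l -> 'I_n) (t : 'I_l' -> 'I_n)
    (a : 'S_l) (b : 'S_l') :
  vdm (cat_fun (fun k => s (a k)) (fun k => t (b k))) =
  (-1) ^+ a * (-1) ^+ b * vdm (cat_fun s t).
Proof.
rewrite !vdm_cat !vdm_perm.
have -> : vdm2 (fun k => s (a k)) (fun k => t (b k)) = vdm2 s t.
  rewrite /vdm2 [RHS](reindex_inj (@perm_inj _ a)); apply: eq_bigr => i _ /=.
  by rewrite [RHS](reindex_inj (@perm_inj _ b)).
by rewrite mulrACA -!mulrA.
Qed.

End Vandermonde.

(** Each inverted pair contributes one negative factor to the product. *)
Lemma sgr_prod_inversions (s : seq nat) : uniq s ->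
  (\prod_(i < size s) \prod_(j < size s | (i < j)%N)
     ((nth 0 s j)%N%:Z - (nth 0 s i)%N%:Z) < 0) = odd (inversions s).
Proof.
move=> s_uniq; rewrite pair_big_dep /=.
pose y (x : 'I_(size s) * 'I_(size s)) :=
  (nth 0 s x.2)%N%:Z - (nth 0 s x.1)%N%:Z.
pose neg (x : 'I_(size s) * 'I_(size s)) := (nth 0 s x.2 < nth 0 s x.1)%N.
have yE x : y x = (-1) ^+ neg x * `|y x|.
  rewrite /y /neg; case: ltnP => h.
    by rewrite mulN1r ltr0_norm ?opprK // subr_lt0 ltz_nat.
  by rewrite mul1r ger0_norm // subr_ge0 lez_nat.
rewrite (eq_bigr (fun x => (-1) ^+ neg x * `|y x|)) => [|x _]; last exact: yE.
rewrite big_split prodrXr /=.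
have -> : (\sum_(x : 'I_(size s) * 'I_(size s) | (x.1 < x.2)%N) neg x)%N =
    inversions s.
  rewrite /inversions -sum1dep_card big_mkcondr /=.
  by apply: eq_bigr => x _; rewrite /neg; case: ltnP.
have : 0 < \prod_(x : 'I_(size s) * 'I_(size s) | (x.1 < x.2)%N) `|y x|.
  apply: prodr_gt0 => x x12; rewrite normr_gt0 subr_eq0 eqz_nat nth_uniq //.
  by rewrite eq_sym neq_ltn x12.
move=> y0; rewrite -signr_odd; case: odd; rewrite ?mulN1r ?oppr_lt0 ?mul1r ?y0 //.
by rewrite ltNge ltW.
Qed.

Lemma set_invE n l l' (S1 : dset n l) (S2 : dset n l') :
  [disjoint val S1 & val S2] ->
  odd (set_inv S1 S2) = vsign (cat_fun (elt S1) (elt S2)).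
Proof.
move=> dis; rewrite /set_inv -sgr_prod_inversions; last first.
  rewrite cat_uniq !map_inj_uniq ?enum_uniq ?andbT /=; try exact: val_inj.
  apply/hasP=> -[_ /mapP[i i2 ->]] /mapP[j j1 /val_inj e].
  by move: i2 j1; rewrite !mem_enum -e => i2 /(disjointFr dis); rewrite i2.
set s := _ ++ _.
have sz1 : size (enum (val S1)) = l by rewrite -cardE (eqP (valP S1)).
have sz2 : size (enum (val S2)) = l' by rewrite -cardE (eqP (valP S2)).
have sz : (l + l')%N = size s by rewrite size_cat !size_map sz1 sz2.
have nthE (k : 'I_(l + l')) : nth 0 s k = cat_fun (elt S1) (elt S2) k :> nat.
  case: (split_ordP k) => i ->;
    rewrite ?cat_funl ?cat_funr /s nth_cat size_map sz1 /=.
    have x0 : 'I_n := elt S1 i.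
    rewrite ltn_ord (nth_map x0) ?sz1 // /elt (enum_val_nth x0) //.
  have x0 : 'I_n := elt S2 i.
  rewrite ltnNge leq_addr /= addKn (nth_map x0) ?sz2 // /elt (enum_val_nth x0) //.
rewrite /vsign /vdm.
move: nthE; rewrite -/s; case: _ / sz => nthE; congr (_ < 0).
by apply: eq_bigr => i _; apply: eq_bigr => j _; rewrite !nthE.
Qed.

(** The combinatorial content of the Laplace expansion along two blocks, for an
    arbitrary function [F] of sequences: an ordering of [S] is a choice of the
    set [S1] of its first [l] entries, of the complement [S2], and of an
    ordering of each, and (-1) ^+ set_inv S1 S2 is the sign that makes this
    compatible with signatures. Nothing is moved past the values of [F], which
    may be terms of noncommutative column determinants. *)
Lemma laplace_split (A : pzRingType) n l l' (S : dset n (l + l'))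
    (F : {ffun 'I_(l + l') -> 'I_n} -> A) :
  \sum_(S1 : dset n l) \sum_(S2 : dset n l' | splits S S1 S2)
    (-1) ^+ set_inv S1 S2 * (\sum_(a : 'S_l) \sum_(b : 'S_l')
      (-1) ^+ a * (-1) ^+ b * F (cat_fun (elt_perm S1 a) (elt_perm S2 b))) =
  \sum_(r : 'S_(l + l')) (-1) ^+ r * F (elt_perm S r).
Proof.
pose G (s : {ffun 'I_(l + l') -> 'I_n}) := (-1) ^+ vsign s * F s.
pose im d (s : {ffun 'I_d -> 'I_n}) := s @: [set: 'I_d].
transitivity (\sum_(r : 'S_(l + l')) G (elt_perm S r)); last first.
  by apply: eq_bigr => r _; rewrite /G vsign_elt_perm.
rewrite -sum_seqs_onto.
pose ok (s1 : {ffun 'I_l -> 'I_n}) (s2 : {ffun 'I_l' -> 'I_n}) :=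
  [disjoint im l s1 & im l' s2] && (im l s1 :|: im l' s2 == val S).
transitivity (\sum_(s1 : {ffun 'I_l -> 'I_n} | injectiveb s1)
     \sum_(s2 : {ffun 'I_l' -> 'I_n} | injectiveb s2)
   if ok s1 s2 then G (cat_fun s1 s2) else 0).
  rewrite sum_inj_seqs; apply: eq_bigr => S1 _.
  transitivity (\sum_(S2 : dset n l' | splits S S1 S2) \sum_(a : 'S_l)
     \sum_(b : 'S_l') G (cat_fun (elt_perm S1 a) (elt_perm S2 b))); last first.
    rewrite exchange_big; apply: eq_bigr => a _ /=.
    rewrite big_mkcond sum_inj_seqs; apply: eq_bigr => S2 _ /=.
    rewrite /ok /im !elt_perm_imset -/(splits S S1 S2).
    under [RHS]eq_bigr => b _ do rewrite !elt_perm_imset -/(splits S S1 S2).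
    by case: ifP => // _; rewrite big1.
  apply: eq_bigr => S2 /andP[dis _]; rewrite mulr_sumr; apply: eq_bigr => a _.
  rewrite mulr_sumr; apply: eq_bigr => b _; rewrite /G !mulrA; congr (_ * _).
  rewrite -signr_odd set_invE // -!signr_addb; congr (_ ^+ nat_of_bool _).
  (* The two signs agree because reordering within the blocks multiplies the
     Vandermonde product of the concatenation by the two signatures. *)
  have inj12 : injective (cat_fun (elt S1) (elt S2)).
    apply/injectiveP; rewrite cat_fun_injectiveb !elt_imset dis andbT.
    by apply/andP; split; apply/injectiveP; apply: elt_inj.
  have := vdm_cat_perm (elt S1) (elt S2) a b; move/vdm_neq0: inj12.
  rewrite /vsign (eq_vdm (s := cat_fun (elt_perm S1 a) _)
    (t := cat_fun (fun k => elt S1 (a k)) (fun k => elt S2 (b k)))).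
    move=> v0 ->; move: v0; case: (odd_perm a); case: (odd_perm b);
      rewrite ?mulN1r ?mul1r ?opprK ?oppr_lt0 ?addbT ?addbF //=;
      by case: ltgtP.
  by move=> k; rewrite !ffunE; case: split => i; rewrite ffunE.
rewrite pair_big /= -big_mkcondr /=.
rewrite [RHS](reindex (fun x : {ffun 'I_l -> 'I_n} * {ffun 'I_l' -> 'I_n} =>
   cat_fun x.1 x.2)) /=; last first.
  exists (fun s => ([ffun i => s (lshift l' i)], [ffun j => s (rshift l j)])).
    move=> [s1 s2] _ /=; congr (_, _); apply/ffunP=> i; rewrite ffunE ?cat_funl //.
    exact: cat_funr.
  move=> s _; apply/ffunP=> k /=.
  by case: (split_ordP k) => i ->; rewrite ?cat_funl ?cat_funr ffunE.
apply: eq_bigl => -[s1 s2] /=.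
by rewrite cat_fun_injectiveb cat_fun_imset !andbA.
Qed.

(** * Alternating traces *)

Lemma eq_oppr_eq0 (C : numFieldType) (V : lmodType C) (x : V) :
  x = - x -> x = 0.
Proof.
move=> xN; have : (2%:R : C) *: x = 0.
  by rewrite scaler_nat mulr2n {1}xN addNr.
by move/(congr1 (fun v => (2%:R : C)^-1 *: v)); rewrite scalerA mulVf
  ?pnatr_eq0 // scale1r scaler0.
Qed.

Section AlternatingTrace.
Variables (C : numFieldType) (A : algType C) (n d : nat).
Implicit Type M : 'I_d -> 'M[A]_n.

(** The trace of the composition of [M_1 (x) ... (x) M_d], whose product is
    taken in this order, with the (unnormalized) antisymmetrizer of the d-th
    tensor power. Both elements of the theorem, and their images, are
    combinations of such traces. *)
Definition alt_trace M : A :=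
  \sum_(s : {ffun 'I_d -> 'I_n}) \sum_(r : 'S_d)
    (-1) ^+ r * \prod_(k < d) M k (s k) (s (r k)).

(** A transposition of two positions where [s] agrees reverses all signs. *)
Lemma sum_perm_noninj (s : {ffun 'I_d -> 'I_n}) (f : {ffun 'I_d -> 'I_n} -> A) :
  ~~ injectiveb s ->
  \sum_(r : 'S_d) (-1) ^+ r * f [ffun k => s (r k)] = 0.
Proof.
move/injectivePn=> [i [j ij sij]]; apply: (@eq_oppr_eq0 C).
rewrite {1}(reindex_inj (mulIg (tperm i j))) -sumrN /=.
apply: eq_bigr => r _; rewrite odd_permM odd_tperm ij signr_addb mulrN1 mulNr.
congr (- (_ * f _)); apply/ffunP=> k; rewrite !ffunE permM.
by case: tpermP => [->|->|].
Qed.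

(** The sequences with a repetition contribute nothing, the others are
    arrangements of subsets. Hence an alternating trace is a sum over subsets
    of fully antisymmetrized principal minors. *)
Lemma alt_trace_sets M : alt_trace M =
  \sum_(S : dset n d) \sum_(s : 'S_d) \sum_(t : 'S_d) (-1) ^+ s * (-1) ^+ t *
    \prod_(k < d) M k (elt S (s k)) (elt S (t k)).
Proof.
rewrite /alt_trace (bigID (fun s : {ffun 'I_d -> 'I_n} => injectiveb s)) /=.
rewrite [X in _ + X]big1 ?addr0; last first.
  move=> s s_ninj.
  rewrite -[RHS](@sum_perm_noninj s
    (fun t => \prod_(k < d) M k (s k) (t k))) //.
  apply: eq_bigr => r _; congr (_ * _).
  by apply: eq_bigr => k _; rewrite ffunE.
rewrite sum_inj_seqs; apply: eq_bigr => S _; apply: eq_bigr => s _.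
rewrite [RHS](reindex_inj (mulIg s)); apply: eq_bigr => r _ /=.
rewrite odd_permM -signr_addb [odd_perm r (+) _]addbC addKb.
by congr (_ * _); apply: eq_bigr => k _; rewrite !ffunE permM.
Qed.

End AlternatingTrace.

Lemma eq_alt_trace (C : numFieldType) (A : algType C) n d (M N : 'I_d -> 'M[A]_n) :
  M =1 N -> alt_trace M = alt_trace N.
Proof.
move=> MN; apply: eq_bigr => s _; apply: eq_bigr => r _; congr (_ * _).
by apply: eq_bigr => k _; rewrite MN.
Qed.

Lemma rmorph_alt_trace (C : numFieldType) (A B : algType C) n d
    (f : {rmorphism A -> B}) (M : 'I_d -> 'M[A]_n) :
  f (alt_trace M) = alt_trace (fun k => map_mx f (M k)).
Proof.
rewrite rmorph_sum; apply: eq_bigr => s _; rewrite rmorph_sum.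
apply: eq_bigr => r _; rewrite rmorphM rmorph_sign rmorph_prod.
by congr (_ * _); apply: eq_bigr => k _; rewrite mxE.
Qed.

(** The antisymmetrizer commutes with [g (x) ... (x) g], so the trace does not
    see a simultaneous conjugation. Only the scalars coming from [g] and [h]
    are moved; the order of the factors [M k] never changes. *)
Lemma alt_trace_conj (C : numFieldType) (A : algType C) n d
    (M N : 'I_d -> 'M[A]_n) (g h : 'M[C]_n) :
  h *m g = 1%:M ->
  (forall k a b, N k a b = \sum_c \sum_e (g a c * h e b) *: M k c e) ->
  alt_trace N = alt_trace M.
Proof.
move=> hg NE; rewrite /alt_trace.
under eq_bigr => s _.
  under eq_bigr => r _.
    under eq_bigr => k _ do rewrite NE.
    rewrite bigA_distr_bigA /=.
    under eq_bigr => y _ do rewrite bigA_distr_bigA /=.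
    rewrite mulr_sumr.
    under eq_bigr => y _.
      rewrite mulr_sumr.
      under eq_bigr => z _ do rewrite scaler_prod.
      over.
    over.
  over.
(* For a fixed permutation, sum over the sequence s first: the scalars then
   multiply to entries of h *m g, which leaves only the pairs of sequences with
   z = y o r. *)
rewrite exchange_big [RHS]exchange_big; apply: eq_bigr => r _ /=.
rewrite exchange_big; apply: eq_bigr => y _ /=.
rewrite exchange_big /= (bigD1 [ffun k => y (r k)]) //= [X in _ + X]big1 ?addr0.
  rewrite -mulr_sumr -scaler_suml.
  rewrite (_ : \sum_s _ = 1) ?scale1r.
    by congr (_ * _); apply: eq_bigr => k _; rewrite ffunE.
  under eq_bigr => s _.
    rewrite big_split /= [X in _ * X](reindex_inj (@perm_inj _ r^-1%g)) /=.
    rewrite -big_split /=.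
    under eq_bigr => k _ do rewrite ffunE !permKV mulrC.
    over.
  rewrite -(bigA_distr_bigA (fun k a => h (y k) a * g a (y k))) /=.
  rewrite big1 // => k _.
  by move/matrixP/(_ (y k) (y k)): hg; rewrite !mxE eqxx.
move=> z zy; rewrite -mulr_sumr -scaler_suml.
rewrite (_ : \sum_s _ = 0) ?scale0r ?mulr0 //.
under eq_bigr => s _.
  rewrite big_split /= [X in _ * X](reindex_inj (@perm_inj _ r^-1%g)) /=.
  rewrite -big_split /=.
  under eq_bigr => k _ do rewrite permKV mulrC.
  over.
rewrite -(bigA_distr_bigA (fun k a => h (z (r^-1%g k)) a * g a (y k))) /=.
have [k zk] : exists k, z k != y (r k).
  apply/existsP; apply: contraNT zy; rewrite negb_exists => /forallP zy.
  by apply/eqP/ffunP=> k; rewrite ffunE; apply/eqP; rewrite -[_ == _]negbK.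
rewrite (bigD1 (r k)) //= permK.
move/matrixP/(_ (z k) (y (r k))): hg; rewrite !mxE (negPf zk) => ->.
by rewrite mul0r.
Qed.

(** * Column determinants *)

(** Adjacent transpositions generate the symmetric group. *)
Lemma perm_adjacent_ind l (P : 'S_l -> Prop) :
  P 1%g -> (forall r r', P r -> P r' -> P (r * r')%g) ->
  (forall k0 k1 : 'I_l, k1 = k0.+1 :> nat -> P (tperm k0 k1)) ->
  forall r, P r.
Proof.
move=> P1 PM Padj.
have Plt d (i j : 'I_l) : j = (i + d)%N :> nat -> P (tperm i j).
  elim: d j => [|d IHd] j jE.
    by rewrite (_ : j = i) ?tperm1 //; apply: val_inj; rewrite [LHS]jE addn0.
  have k_lt : (i + d < l)%N by rewrite (leq_trans _ (ltn_ord j)) // jE addnS.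
  pose k := Ordinal k_lt.
  have kj : j = k.+1 :> nat by rewrite jE addnS.
  have [d0|d0] := posnP d; first by apply: Padj; rewrite kj /= d0 addn0.
  rewrite (_ : tperm i j = (tperm k j * (tperm i k * tperm k j))%g).
    exact: (PM _ _ (Padj _ _ kj) (PM _ _ (IHd k erefl) (Padj _ _ kj))).
  rewrite -{1}[tperm k j]tpermV -[RHS]/(tperm i k ^ tperm k j)%g tpermJ tpermL.
  rewrite tpermD // -val_eqE /= ?jE; last first.
    by rewrite gtn_eqF // addnS ltnS leq_addr.
  by rewrite gtn_eqF // -{1}[val i]addn0 ltn_add2l.
move=> r; have [ts -> _] := prod_tpermP r.
elim: ts => [|x ts IH]; rewrite ?big_nil ?big_cons //; apply: PM => //.
case: (leqP x.1 x.2) => h; first by apply: (Plt (x.2 - x.1)%N); rewrite subnKC.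
by rewrite tpermC; apply: (Plt (x.1 - x.2)%N); rewrite subnKC // ltnW.
Qed.

Lemma prod_adjacent (A : pzRingType) l i r (e : (i + r.+2)%N = l)
    (F : 'I_l -> A) (k0 k1 : 'I_l) : k0 = i :> nat -> k1 = i.+1 :> nat ->
  \prod_(k < l) F k =
  (\prod_(j < i) F (cast_ord e (lshift r.+2 j))) * (F k0 * F k1) *
  \prod_(j < r) F (cast_ord e (rshift i (lift ord0 (lift ord0 j)))).
Proof.
case: l / e F k0 k1 => F k0 k1 k0E k1E.
have -> : k0 = rshift i ord0 by apply: val_inj; rewrite /= addn0.
have -> : k1 = rshift i (lift ord0 ord0) by apply: val_inj; rewrite /= addn1.
rewrite big_split_ord /= 2!big_ord_recl /= -!mulrA.
by congr (_ * (_ * (_ * _))); apply: eq_bigr => j _; rewrite cast_ord_id.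
Qed.

(** A relation between products of two consecutive factors may be used inside
    longer ordered products. *)
Lemma prod_adjacent_eq (A : pzRingType) l (k0 k1 : 'I_l)
    (F1 F2 F3 F4 : 'I_l -> A) : k1 = k0.+1 :> nat ->
  (forall k, k != k0 -> k != k1 -> [/\ F1 k = F4 k, F2 k = F4 k & F3 k = F4 k]) ->
  F1 k0 * F1 k1 + F2 k0 * F2 k1 = F3 k0 * F3 k1 + F4 k0 * F4 k1 ->
  \prod_k F1 k + \prod_k F2 k = \prod_k F3 k + \prod_k F4 k.
Proof.
move=> k1E off mid.
have e : (k0 + (l - k0.+2).+2)%N = l.
  by rewrite -addSnnS -addSnnS subnKC // -k1E.
rewrite !(prod_adjacent e _ (erefl : k0 = k0 :> nat) k1E).
have offl F (j : 'I_k0) : (forall k, k != k0 -> k != k1 -> F k = F4 k) ->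
    F (cast_ord e (lshift _ j)) = F4 (cast_ord e (lshift _ j)).
  by move=> ->//; rewrite -val_eqE /= ?k1E ltn_eqF // ltnS ltnW.
have offr F (j : 'I_(l - k0.+2)) :
    (forall k, k != k0 -> k != k1 -> F k = F4 k) ->
    F (cast_ord e (rshift k0 (lift ord0 (lift ord0 j)))) =
    F4 (cast_ord e (rshift k0 (lift ord0 (lift ord0 j)))).
  move=> ->//; rewrite -val_eqE /= ?k1E /bump /=.
    by rewrite gtn_eqF // addnS ltnS leq_addr.
  by rewrite gtn_eqF // !add1n 2!addnS !ltnS leq_addr.
have off1 k : k != k0 -> k != k1 -> F1 k = F4 k.
  by move=> h0 h1; case: (off k h0 h1).
have off2 k : k != k0 -> k != k1 -> F2 k = F4 k.
  by move=> h0 h1; case: (off k h0 h1).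
have off3 k : k != k0 -> k != k1 -> F3 k = F4 k.
  by move=> h0 h1; case: (off k h0 h1).
rewrite (eq_bigr _ (fun j _ => offl F1 j off1)).
rewrite (eq_bigr _ (fun j _ => offl F2 j off2)).
rewrite (eq_bigr _ (fun j _ => offl F3 j off3)).
rewrite (eq_bigr _ (fun j _ => offr F1 j off1)).
rewrite (eq_bigr _ (fun j _ => offr F2 j off2)).
rewrite (eq_bigr _ (fun j _ => offr F3 j off3)).
by rewrite -!mulrDl -!mulrDr mid.
Qed.

Section ColumnDet.
Variables (C : numFieldType) (A : algType C) (n : nat).

(** The column determinant of the text, for arbitrary sequences of rows and
    columns instead of increasing ones; antisymmetry in the columns can only be
    stated in this form. *)
Definition column_det l (E : 'M[A]_n) (u : 'I_l -> C) (s t : 'I_l -> 'I_n) : A :=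
  \sum_(r : 'S_l) (-1) ^+ r *
    \prod_(k < l) (E (s (r k)) (t k) + (u k *+ (s (r k) == t k))%:A).

Lemma eq_column_det l (E : 'M[A]_n) (u : 'I_l -> C) s s' t t' :
  s =1 s' -> t =1 t' ->
  column_det E u s t = column_det E u s' t'.
Proof.
move=> ss tt; apply: eq_bigr => r _; congr (_ * _); apply: eq_bigr => i _.
by rewrite ss tt.
Qed.

(** The commutation relations of the matrix units of gl_n for [c = 1], and
    those of their transposes for [c = -1]. *)
Definition gl_relations (c : C) (E : 'M[A]_n) := forall a b x y,
  E a b * E x y - E x y * E a b =
  c *: ((b == x)%:R *: E a y - (y == a)%:R *: E x b).

Lemma gl_relations_shift c E (u : C) : gl_relations c E ->
  gl_relations c (\matrix_(a, b) (E a b + (u *+ (a == b))%:A)).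
Proof.
move=> glE a b x y; rewrite !mxE comm_add_scalar glE; congr (c *: _).
rewrite !scalerDr !scalerA opprD addrACA -scalerBl.
rewrite [X in _ = _ + X *: 1](_ : _ = 0) ?scale0r ?addr0 //.
rewrite [y == a]eq_sym [x == b]eq_sym.
by case: (b == x); case: (a == y); rewrite ?mulr0n ?mul0r ?mulr0 ?subrr ?mulr0.
Qed.

(** The quadratic relations behind the antisymmetry of column determinants: the
    2 x 2 determinants with diagonal shifts [u, v] are antisymmetric in their
    columns [x, y] exactly because the difference of the shifts compensates for
    the commutators. *)
Lemma gl_exchange c E (u v : C) a b x y : gl_relations c E -> u - v = c ->
  (E a x + (u *+ (a == x))%:A) * (E b y + (v *+ (b == y))%:A) +
  (E a y + (u *+ (a == y))%:A) * (E b x + (v *+ (b == x))%:A) =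
  (E b x + (u *+ (b == x))%:A) * (E a y + (v *+ (a == y))%:A) +
  (E b y + (u *+ (b == y))%:A) * (E a x + (v *+ (a == x))%:A).
Proof.
move=> glE uvc; have {}glE := gl_relations_shift u glE.
set B := \matrix_(_, _) _ in glE.
have BE k h : E k h + (u *+ (k == h))%:A = B k h by rewrite mxE.
have BE' k h : E k h + (v *+ (k == h))%:A = B k h - ((k == h)%:R * c)%:A.
  rewrite -BE -addrA -scalerBl -uvc mulrBr !mulr_natl.
  by rewrite opprB addrCA subrr addr0.
(* With the first shift absorbed into the matrix, whose commutation relations
   are not affected, only the constant c remains. *)
rewrite !BE !BE' !mulrBr !mulr_algr.
have /eqP := glE a x b y; rewrite subr_eq => /eqP ->.
have /eqP := glE a y b x; rewrite subr_eq => /eqP ->.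
rewrite !scalerBr !scalerA ![c * _]mulrC [x == b]eq_sym [y == a]eq_sym.
rewrite [y == b]eq_sym [x == a]eq_sym.
move: (B b y * B a x) (B b x * B a y) => P S.
move: (_ *: B a y) (_ *: B b x) (_ *: B a x) (_ *: B b y) => W R Q T.
rewrite (AC (((2*1)*1)*((2*1)*1)) ((6*2)*(3*7)*(4*5)*(1*8)))%AC /=.
by rewrite addNr addr0 subrr addr0 [RHS](AC (2*2) ((4*2)*(3*1))).
Qed.

(** Pairing each permutation of the rows with its product by the transposition
    reduces the claim to the quadratic relations between two neighbouring
    columns. *)
Lemma column_det_adjacent l c E (u : 'I_l -> C) (s t : 'I_l -> 'I_n)
    (k0 k1 : 'I_l) :
  gl_relations c E -> k1 = k0.+1 :> nat -> u k0 - u k1 = c ->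
  column_det E u s (fun k => t (tperm k0 k1 k)) = - column_det E u s t.
Proof.
move=> glE k1E uc; apply/eqP; rewrite -addr_eq0 addrC; apply/eqP.
have k01 : k0 != k1 by rewrite -val_eqE /= k1E ltn_eqF.
apply: (@eq_oppr_eq0 C); rewrite /column_det -big_split /=.
rewrite {1}(reindex_inj (mulgI (tperm k0 k1))) -sumrN /=.
apply: eq_bigr => r _; rewrite odd_permM odd_tperm k01 signr_addb mulN1r.
rewrite -!mulrDr mulNr; congr (- (_ * _)).
apply: (@prod_adjacent_eq _ _ k0 k1) => // [k kk0 kk1|].
  by rewrite permM tpermD // eq_sym.
rewrite !permM tpermL tpermR; apply: gl_exchange glE uc.
Qed.

(** Over a commutative ring this is trivial; here it is the reason for the
    arithmetic progression of the shifts. *)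
Lemma column_det_perm l c E (u : 'I_l -> C) (s t : 'I_l -> 'I_n) (r : 'S_l) :
  gl_relations c E ->
  (forall k0 k1 : 'I_l, k1 = k0.+1 :> nat -> u k0 - u k1 = c) ->
  column_det E u s (fun k => t (r k)) = (-1) ^+ r * column_det E u s t.
Proof.
move=> glE uc; elim/perm_adjacent_ind: r t => [|r r' IH IH'|k0 k1 k1E] t.
- rewrite odd_perm1 mul1r; apply: eq_bigr => r _; congr (_ * _).
  by apply: eq_bigr => k _; rewrite perm1.
- rewrite odd_permM signr_addb -mulrA -IH' -IH.
  apply: eq_bigr => x _; congr (_ * _).
  by apply: eq_bigr => k _; rewrite permM.
rewrite (column_det_adjacent _ _ glE) ?odd_tperm ?uc //.
rewrite -val_eqE /= k1E ltn_eqF //.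
by rewrite mulN1r.
Qed.

End ColumnDet.

Lemma mulr_signCA (A : pzRingType) (x y : A) n :
  x * ((-1) ^+ n * y) = (-1) ^+ n * (x * y).
Proof. by rewrite mulrA commr_sign -mulrA. Qed.

Section BlockShift.
Variables (C : numFieldType) (A : algType C) (n l l' : nat).
Variables (E1 E2 : 'M[A]_n) (u1 : 'I_l -> C) (u2 : 'I_l' -> C).

(** The factors of a product of two column determinants, in their order. *)
Definition cat_shift (k : 'I_(l + l')) : 'M[A]_n :=
  match split k with
  | inl i => \matrix_(a, b) (E1 a b + (u1 i *+ (a == b))%:A)
  | inr j => \matrix_(a, b) (E2 a b + (u2 j *+ (a == b))%:A)
  end.

Lemma column_det_mul (s1 t1 : 'I_l -> 'I_n) (s2 t2 : 'I_l' -> 'I_n) :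
  column_det E1 u1 s1 t1 * column_det E2 u2 s2 t2 =
  \sum_(a : 'S_l) \sum_(b : 'S_l') (-1) ^+ a * (-1) ^+ b *
    \prod_k cat_shift k (cat_fun (fun i => s1 (a i)) (fun j => s2 (b j)) k)
                        (cat_fun t1 t2 k).
Proof.
rewrite mulr_suml; apply: eq_bigr => a _; rewrite mulr_sumr.
apply: eq_bigr => b _; rewrite -!mulrA mulr_signCA; congr (_ * (_ * _)).
rewrite big_split_ord; congr (_ * _); apply: eq_bigr => i _.
  by rewrite !cat_funl /cat_shift (unsplitK (inl i : 'I_l + 'I_l')) mxE.
by rewrite !cat_funr /cat_shift (unsplitK (inr i : 'I_l + 'I_l')) mxE.
Qed.

(** Column determinants are antisymmetrized in their rows by definition and in
    their columns by [column_det_perm], so that the sums over complementary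
    sets of rows and of columns are both instances of [laplace_split].
    Antisymmetrizing the columns as well produces each term l! l'! times. *)
Lemma sum_column_det_alt_trace (c1 c2 : C) :
  gl_relations c1 E1 -> gl_relations c2 E2 ->
  (forall k0 k1 : 'I_l, k1 = k0.+1 :> nat -> u1 k0 - u1 k1 = c1) ->
  (forall k0 k1 : 'I_l', k1 = k0.+1 :> nat -> u2 k0 - u2 k1 = c2) ->
  \sum_(S : dset n (l + l'))
  \sum_(S1 : dset n l) \sum_(S2 : dset n l' | splits S S1 S2)
  \sum_(T1 : dset n l) \sum_(T2 : dset n l' | splits S T1 T2)
    (-1) ^+ (set_inv S1 S2 + set_inv T1 T2)
    * column_det E1 u1 (elt S1) (elt T1) * column_det E2 u2 (elt S2) (elt T2) =
  ((l`! * l'`!)%:R^-1 : C) *: alt_trace cat_shift.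
Proof.
move=> gl1 gl2 uc1 uc2; rewrite alt_trace_sets scaler_sumr; apply: eq_bigr => S _.
pose H (t : {ffun 'I_(l + l') -> 'I_n}) := \sum_(r : 'S_(l + l'))
  (-1) ^+ r * \prod_k cat_shift k (elt_perm S r k) (t k).
have HE t1 t2 : H (cat_fun t1 t2) =
    \sum_(S1 : dset n l) \sum_(S2 : dset n l' | splits S S1 S2)
      (-1) ^+ set_inv S1 S2 *
      (column_det E1 u1 (elt S1) t1 * column_det E2 u2 (elt S2) t2).
  apply: etrans (esym (laplace_split S
    (fun s => \prod_k cat_shift k (s k) (cat_fun t1 t2 k)))) _.
  apply: eq_bigr => S1 _; apply: eq_bigr => S2 _; rewrite column_det_mul.
  congr (_ * _); apply: eq_bigr => a _; apply: eq_bigr => b _; congr (_ * _).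
  apply: eq_bigr => k _; congr (cat_shift k _ _).
  by rewrite !ffunE; case: split => i; rewrite ffunE.
transitivity (((l`! * l'`!)%:R^-1 : C) *:
    \sum_(t : 'S_(l + l')) (-1) ^+ t * H (elt_perm S t)); last first.
  congr (_ *: _); rewrite [RHS]exchange_big; apply: eq_bigr => t _ /=.
  rewrite mulr_sumr; apply: eq_bigr => s _; rewrite mulr_signCA -mulrA.
  by congr (_ * (_ * _)); apply: eq_bigr => k _; rewrite !ffunE.
rewrite -laplace_split scaler_sumr.
under eq_bigr => S1 _ do rewrite exchange_big.
rewrite exchange_big; apply: eq_bigr => T1 _ /=.
under eq_bigr => S1 _ do rewrite exchange_big.
rewrite exchange_big scaler_sumr; apply: eq_bigr => T2 _ /=.
have c0 k : k`!%:R != 0 :> C by rewrite pnatr_eq0 -lt0n fact_gt0.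
transitivity ((-1) ^+ set_inv T1 T2 * H (cat_fun (elt T1) (elt T2))).
  rewrite HE mulr_sumr; apply: eq_bigr => S1 _; rewrite mulr_sumr.
  by apply: eq_bigr => S2 _; rewrite addnC exprD -!mulrA.
rewrite scalerAr; congr (_ * _); apply: (canRL (scalerK _)).
  by rewrite natrM mulf_neq0.
have HEab (a : 'S_l) (b : 'S_l') :
    (-1) ^+ a * (-1) ^+ b * H (cat_fun (elt_perm T1 a) (elt_perm T2 b)) =
    H (cat_fun (elt T1) (elt T2)).
  rewrite !HE mulr_sumr; apply: eq_bigr => S1 _; rewrite mulr_sumr.
  apply: eq_bigr => S2 _; rewrite mulr_signCA; congr (_ * _).
  rewrite (eq_column_det _ _ (frefl (elt S1)) (elt_permE T1 a)).
  rewrite (eq_column_det _ _ (frefl (elt S2)) (elt_permE T2 b)).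
  rewrite (column_det_perm _ _ _ gl1 uc1) (column_det_perm _ _ _ gl2 uc2).
  rewrite -[(-1) ^+ a * column_det _ _ _ _ * _]mulrA.
  rewrite [column_det _ _ _ _ * ((-1) ^+ b * _)]mulr_signCA.
  by rewrite !mulrA -!signr_addb -addbA addbb mul1r.
under [RHS]eq_bigr => a _.
  under eq_bigr => b _ do rewrite HEab.
  over.
by rewrite !sumr_const !card_Sn -mulrnA scaler_nat mulnC.
Qed.

End BlockShift.

(** * Invariance under the adjoint actions *)

Lemma map_in_alg (C : comNzRingType) (A B : algType C) (f : {lrmorphism A -> B})
    n (N : 'M[C]_n) :
  map_mx f (map_mx (in_alg A) N) = map_mx (in_alg B) N.
Proof. by apply/matrixP=> a b; rewrite !mxE rmorph_alg. Qed.

Lemma map_conjE (C : comNzRingType) (A : algType C) n (g h : 'M[C]_n)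
    (E : 'M[A]_n) a b :
  (map_mx (in_alg A) g *m E *m map_mx (in_alg A) h) a b =
  \sum_c \sum_e (g a c * h e b) *: E c e.
Proof.
rewrite mxE exchange_big; apply: eq_bigr => e _; rewrite !mxE mulr_suml.
by apply: eq_bigr => c _; rewrite !mxE mulr_algr mulr_algl scalerA mulrC.
Qed.

Lemma alt_trace_conjmx (C : numFieldType) (A : algType C) n d
    (M N : 'I_d -> 'M[A]_n) (g h : 'M[C]_n) :
  h *m g = 1%:M ->
  (forall k, N k = map_mx (in_alg A) g *m M k *m map_mx (in_alg A) h) ->
  alt_trace N = alt_trace M.
Proof.
by move=> hg NE; apply: (alt_trace_conj hg) => k a b; rewrite NE map_conjE.
Qed.

Lemma conj_delta (C : comNzRingType) n (x y : 'M[C]_n) s t :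
  x *m delta_mx s t *m y = \sum_a \sum_b (x a s * y t b) *: delta_mx a b.
Proof.
rewrite [LHS]matrix_sum_delta; apply: eq_bigr => a _; apply: eq_bigr => b _.
congr (_ *: _); rewrite mxE (bigD1 t) //= big1 ?addr0.
  rewrite mxE (bigD1 s) //= big1 ?addr0 ?mxE ?eqxx ?mulr1 // => j /negPf js.
  by rewrite mxE js mulr0.
move=> j /negPf jt; rewrite mxE big1 ?mul0r // => i _.
by rewrite mxE jt andbF mulr0.
Qed.

(** The homomorphism induced on the enveloping algebra, with the structures
    needed to distribute it over sums and products. *)
Definition lift_lrmorphism (K : comNzRingType) (L : lieType K) (A : algType K)
    (f : L -> A) (f_lie : lie_morphism f) : {lrmorphism uea L -> A} :=
  HB.pack (uea_lift f)
    (GRing.isLinear.Build K (uea L) A *:%R (uea_lift f) (uea_lift_linear f_lie))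
    (GRing.isMonoidMorphism.Build (uea L) A (uea_lift f) (uea_lift_monoid f_lie)).

Section InvarianceX.
Variable C : numClosedFieldType.
Variables m p q : nat.
Local Notation U := (Ug C m).
Local Notation mapA := (map_mx (in_alg U)).

(** The factors of the alternating trace for [X_d]: the first [l] come from the
    determinants over E^X and the others from those over the transpose of E^Y,
    each with its entry of alpha or beta as a diagonal shift. At a position
    [k >= l] the index of beta is [k - l], whence the integer part
    [- (d - k - 1)]. *)
Definition X_factor d l (k : 'I_d) : 'M[U]_m :=
  if (k < l)%N then EX C m + mapA ((l - k.+1)%:R - p%:R / 2)%:M
  else (EY C m)^T + mapA (- (d - k.+1)%:R + q%:R / 2)%:M.

Lemma EX_gl : gl_relations 1 (EX C m).
Proof.
move=> a b x y; rewrite !mxE -(uea_gen_morphism _).2 scale1r -!linearZ -linearB /=.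
congr uea_gen; rewrite /lie /= /lie_prod /= liexx; apply/pair_equal_spec.
by split; rewrite /= ?scaler0 ?subrr // /lie /= /gl_lie !mul_delta_mx_cond !scaler_nat.
Qed.

Lemma EYt_gl : gl_relations (-1) (EY C m)^T.
Proof.
move=> a b x y; rewrite !mxE -(uea_gen_morphism _).2 -!linearZ -linearB -linearZ /=.
congr uea_gen; rewrite /lie /= /lie_prod /= liexx; apply/pair_equal_spec.
split; rewrite /= ?scaler0 ?subrr ?scaler0 // scaleN1r opprB.
by rewrite /lie /= /gl_lie !mul_delta_mx_cond !scaler_nat [y == a]eq_sym [b == x]eq_sym.
Qed.

Lemma X_eltE d : X_elt C m p q d =
  \sum_(l < d.+1) ((l`! * (d - l)`!)%:R^-1 : C) *: alt_trace (X_factor (d := d) l).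
Proof.
rewrite /X_elt exchange_big; apply: eq_bigr => l _ /=.
have e : (l + (d - l))%N = d by rewrite subnKC // -ltnS.
move: (nat_of_ord l) (d - l)%N e => {}l l' e; case: d / e.
transitivity (((l`! * l'`!)%:R^-1 : C) *:
   alt_trace (cat_shift (EX C m) (EY C m)^T (alpha C p (l := l)) (beta C q (l := l')))).
  rewrite -(sum_column_det_alt_trace EX_gl EYt_gl) //.
  - move=> k0 k1 k1E; rewrite /alpha opprD addrACA addrN addr0 k1E.
    by rewrite -[(l - k0.+1)%N]subnSK -?k1E // k1E mulrSr addrAC subrr add0r.
  move=> k0 k1 k1E; rewrite /beta opprD addrACA addrN addr0 k1E.
  rewrite -[(l' - k0.+1)%N]subnSK -?k1E // k1E mulrSr opprD opprK addrAC.
  by rewrite addNr add0r.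
congr (_ *: _); rewrite /alt_trace; apply: eq_bigr => s _; apply: eq_bigr => r _.
congr (_ * _); apply: eq_bigr => k _; congr (fun_of_matrix _ _ _).
rewrite /cat_shift /X_factor; case: (split_ordP k) => i ->.
  by apply/matrixP=> a b; rewrite !mxE.
by apply/matrixP=> a b; rewrite !mxE /= -addnS subnDl.
Qed.

(** Under Ad(k), both E^X and the transpose of E^Y are conjugated by the
    transpose of [k], and scalar matrices are not changed by it. *)
Lemma X_elt_invariant d : K_invariant (X_elt C m p q d).
Proof.
move=> k ku; have lieK := Ad_K_morphism ku.
pose Phi : {lrmorphism U -> U} := lift_lrmorphism lieK.
rewrite -[LHS]/(Phi _) X_eltE linear_sum; apply: eq_bigr => l _.
have PhiE x : Phi (uea_gen x) = uea_gen (Ad_K k x) := uea_lift_gen lieK x.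
move: Phi PhiE => {}Phi PhiE; rewrite linearZ /= rmorph_alt_trace; congr (_ *: _).
have gh : k^T *m (invmx k)^T = 1%:M by rewrite -trmx_mul mulVmx ?trmx1.
apply: (@alt_trace_conjmx _ _ _ _ _ _ k^T (invmx k)^T) => [|i].
  by rewrite -trmx_mul mulmxV // trmx1.
have shift (c : C) : map_mx Phi (mapA c%:M) =
    mapA k^T *m mapA c%:M *m mapA (invmx k)^T.
  rewrite -!map_mxM /= mul_mx_scalar -scalemxAl gh scalemx1.
  by apply/matrixP=> a b; rewrite !mxE rmorph_alg.
rewrite /X_factor; case: ifP => _; rewrite map_mxD shift mulmxDr mulmxDl; congr (_ + _).
  apply/matrixP=> a b; rewrite map_conjE !mxE [LHS]PhiE /Ad_K /=.
  rewrite conj_delta mulmx0 mul0mx.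
  transitivity (uea_gen (\sum_x \sum_y
     (k^T a x * (invmx k)^T y b) *: ((delta_mx x y, 0) : 'M[C]_m * 'M[C]_m))).
    congr uea_gen; rewrite [RHS]surjective_pairing; congr (_, _).
      rewrite raddf_sum; apply: eq_bigr => x _; rewrite raddf_sum.
      by apply: eq_bigr => y _; rewrite !mxE.
    rewrite raddf_sum big1 // => x _; rewrite raddf_sum big1 // => y _.
    exact: scaler0.
  rewrite linear_sum; apply: eq_bigr => x _; rewrite linear_sum.
  by apply: eq_bigr => y _; rewrite linearZ !mxE.
apply/matrixP=> a b; rewrite map_conjE !mxE [LHS]PhiE /Ad_K /=.
rewrite conj_delta mulmx0 mul0mx.
transitivity (uea_gen (\sum_x \sum_y
   (k^T a x * (invmx k)^T y b) *: ((0, delta_mx y x) : 'M[C]_m * 'M[C]_m))).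
  congr uea_gen; rewrite [RHS]surjective_pairing; congr (_, _).
    rewrite raddf_sum big1 // => x _; rewrite raddf_sum big1 // => y _.
    exact: scaler0.
  rewrite exchange_big raddf_sum; apply: eq_bigr => x _; rewrite raddf_sum.
  by apply: eq_bigr => y _; rewrite !mxE mulrC.
rewrite linear_sum; apply: eq_bigr => x _; rewrite linear_sum.
by apply: eq_bigr => y _; rewrite linearZ !mxE.
Qed.
End InvarianceX.

Section InvarianceC.
Variable C : numClosedFieldType.
Variables m p q : nat.
Local Notation U := (Um C p q).
Local Notation mapA := (map_mx (in_alg U)).

(** The shift of the symmetrized minor is by [- u_k * eps] with
    [eps = - I_{p,q}], which combines with the subtracted [m/2 I_{p,q}]. *)
Definition C_factor d (k : 'I_d) : 'M[U]_(p + q) :=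
  matB C p q + mapA (((d - k.+1)%:R - m%:R / 2) *: Ipq C p q).

Lemma C_eltE d : C_elt C m p q d = (d`!%:R^-1 : C) *: alt_trace (@C_factor d).
Proof.
rewrite alt_trace_sets scaler_sumr; apply: eq_bigr => J _.
congr (_ *: _); apply: eq_bigr => s _; apply: eq_bigr => t _; congr (_ * _).
apply: eq_bigr => k _; rewrite /C_factor ![(_ + mapA _) _ _]mxE.
rewrite [X in X + _ = _]mxE [(- map_mx _ _) _ _]mxE ![map_mx _ _ _ _]mxE.
rewrite ![(_ *: Ipq _ _ _) _ _]mxE /=.
rewrite -!addrA; congr (_ + _).
by rewrite mulrN scaleNr opprK -scaleNr -scalerDl mulrBl addrC.
Qed.

Lemma block_diag_comm (h1 : 'M[C]_p) (h2 : 'M[C]_q) (x : C) :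
  block_mx h1 0 0 h2 *m block_mx 1%:M 0 0 x%:M =
  block_mx 1%:M 0 0 x%:M *m block_mx h1 0 0 h2.
Proof.
by rewrite !mulmx_block !mulmx0 !mul0mx !mulmx1 !mul1mx !addr0 !add0r scalar_mxC.
Qed.

(** [B] is obtained from the matrix of generators by multiplication with
    diagonal matrices that are scalar on the two blocks, which commute with H,
    and so does [I_{p,q}]. *)
Lemma C_elt_invariant d : H_invariant (C_elt C m p q d).
Proof.
move=> h1 h2 u1 u2; have lieH := Ad_H_morphism u1 u2.
pose Phi : {lrmorphism U -> U} := lift_lrmorphism lieH.
rewrite -[LHS]/(Phi _) C_eltE.
have PhiE x : Phi (uea_gen x) = uea_gen (Ad_H h1 h2 x) := uea_lift_gen lieH x.
move: Phi PhiE => {}Phi PhiE; rewrite linearZ /= rmorph_alt_trace; congr (_ *: _).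
set h := block_mx h1 0 0 h2 in PhiE *.
have hu : h \in unitmx by rewrite unitmxE det_ublock unitrM -!unitmxE u1.
have gh : h^T *m (invmx h)^T = 1%:M by rewrite -trmx_mul mulVmx ?trmx1.
have hg : (invmx h)^T *m h^T = 1%:M by rewrite -trmx_mul mulmxV ?trmx1.
have commg x : h^T *m block_mx 1%:M 0 0 x%:M = block_mx 1%:M 0 0 x%:M *m h^T.
  by rewrite tr_block_mx !trmx0 block_diag_comm.
have commh x : (invmx h)^T *m block_mx 1%:M 0 0 x%:M =
    block_mx 1%:M 0 0 x%:M *m (invmx h)^T.
  rewrite -[LHS]mulmx1 -gh !mulmxA -[_ *m h^T]mulmxA -commg.
  by rewrite [_ *m (h^T *m _)]mulmxA hg mul1mx.
have PhiC (N : 'M[C]_(p + q)) : map_mx Phi (mapA N) = mapA N.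
  by apply/matrixP=> a b; rewrite !mxE rmorph_alg.
apply: (@alt_trace_conjmx _ _ _ _ _ _ h^T (invmx h)^T) => // k.
rewrite map_mxD PhiC mulmxDr mulmxDl; congr (_ + _); last first.
  rewrite -!map_mxM /=; congr map_mx.
  rewrite -scalemxAr -scalemxAl; congr (_ *: _).
  have -> : Ipq C p q = block_mx 1%:M 0 0 (-1)%:M by rewrite /Ipq raddfN.
  by rewrite commg -mulmxA gh mulmx1.
have PhiB : map_mx Phi (matB' C p q) =
    mapA h^T *m matB' C p q *m mapA (invmx h)^T.
  apply/matrixP=> a b; rewrite map_conjE !mxE [LHS]PhiE /Ad_H /= -/h.
  rewrite conj_delta linear_sum; apply: eq_bigr => x _; rewrite linear_sum.
  by apply: eq_bigr => y _; rewrite linearZ !mxE.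
rewrite /matB !map_mxM !PhiC /= PhiB !mulmxA -map_mxM /= /matD -commg map_mxM /=.
by rewrite -!mulmxA -!map_mxM /= commh.
Qed.
End InvarianceC.

(** * Determinants with commuting entries in a noncommutative ring *)

Lemma big_lift_perm (V : nmodType) d (f : 'S_d.+1 -> V) :
  \sum_s f s = \sum_(a : 'I_d.+1) \sum_(s : 'S_d) f (lift_perm ord0 a s).
Proof.
rewrite pair_bigA /=.
pose h (x : 'I_d.+1 * 'S_d) := lift_perm ord0 x.1 x.2.
have h_inj : injective h.
  move=> [a s] [b t]; rewrite /h /= => e.
  have ab : a = b by rewrite -(lift_perm_id ord0 a s) e lift_perm_id.
  subst b; congr (_, _); apply/permP=> k; apply: (@lift_inj _ a).
  by rewrite -!(lift_perm_lift ord0) e.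
rewrite (reindex h) //; apply: onW_bij; apply: inj_card_bij => //.
by rewrite card_prod card_ord !card_Sn factS.
Qed.

(** A product of pairwise commuting elements of a noncommutative ring does not
    depend on the order of its factors. Thus determinants with commuting
    entries keep their usual symmetries, although the ambient ring of
    differential operators is not commutative. *)
Lemma prod_comm_perm (A : pzRingType) d (F : 'I_d -> A) (r : 'S_d) :
  (forall i j, F i * F j = F j * F i) -> \prod_k F (r k) = \prod_k F k.
Proof.
elim/perm_adjacent_ind: r F => [|r r' IH IH'|k0 k1 k1E] F FC.
- by apply: eq_bigr => k _; rewrite perm1.
- rewrite -(IH' F) // -(IH (fun k => F (r' k))) //.
  by apply: eq_bigr => k _; rewrite permM.
have k01 : k0 != k1 by rewrite -val_eqE /= k1E ltn_eqF.
apply: (addIr (\prod_k F k)).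
apply: (@prod_adjacent_eq _ _ k0 k1 (fun k => F (tperm k0 k1 k)) F F F) => //.
  by move=> k kk0 kk1; rewrite tpermD // eq_sym.
by rewrite tpermL tpermR FC.
Qed.

Lemma det_perm_rows (A : pzRingType) d (M : 'M[A]_d) (r : 'S_d) :
  (forall i j k l, M i j * M k l = M k l * M i j) ->
  \det (\matrix_(i, j) M (r i) j) = (-1) ^+ r * \det M.
Proof.
move=> MC; rewrite /determinant (reindex_inj (mulgI r)) mulr_sumr.
apply: eq_bigr => s _; rewrite odd_permM signr_addb -mulrA; congr (_ * (_ * _)).
rewrite -(prod_comm_perm r (F := fun i => M i (s i))) //.
by apply: eq_bigr => k _; rewrite mxE permM.
Qed.

Lemma det_tr_comm (A : pzRingType) d (M : 'M[A]_d) :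
  (forall i j k l, M i j * M k l = M k l * M i j) -> \det M^T = \det M.
Proof.
move=> MC; rewrite /determinant (reindex_inj invg_inj).
apply: eq_bigr => s _; rewrite odd_permV; congr (_ * _).
rewrite -(prod_comm_perm s (F := fun i => M^T i (s^-1%g i))).
  by apply: eq_bigr => k _; rewrite mxE permK.
by move=> i j; rewrite !mxE.
Qed.

Lemma sign_lift_perm (A : pzRingType) d (a : 'I_d.+1) (s : 'S_d) :
  (-1) ^+ lift_perm ord0 a s = (-1) ^+ a * (-1) ^+ s :> A.
Proof. by rewrite odd_lift_perm /= signr_addb signr_odd. Qed.

(** The factors of each term of a determinant are ordered by rows, so that the
    entry of the first row always stands in front. *)
Lemma det_expand_first (A : pzRingType) d (M : 'M[A]_d.+1) :
  \det M =
  \sum_(a < d.+1) (-1) ^+ a * (M ord0 a *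
    \det (\matrix_(i < d, j < d) M (lift ord0 i) (lift a j))).
Proof.
rewrite /determinant big_lift_perm; apply: eq_bigr => a _.
rewrite !mulr_sumr; apply: eq_bigr => s _; rewrite mulr_signCA mulrA.
congr (_ * _); first exact: sign_lift_perm.
rewrite big_ord_recl lift_perm_id; congr (_ * _).
by apply: eq_bigr => k _; rewrite lift_perm_lift mxE.
Qed.

Lemma det_size0 (A : pzRingType) (M : 'M[A]_0) : \det M = 1.
Proof.
rewrite /determinant (big_pred1 1%g) => [|s]; last by rewrite /= [s]permS0 eqxx.
by rewrite big_ord0 odd_perm1 mulr1.
Qed.

Section Leibniz.
Variables (C : comNzRingType) (A : algType C).

Lemma prod_leibniz d (x : A) (F D : 'I_d -> A) (c : 'I_d -> C) :
  (forall k, x * F k = F k * x + c k *: D k) ->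
  x * \prod_k F k = \prod_k F k * x +
    \sum_j c j *: \prod_k (if k == j then D k else F k).
Proof.
elim: d F D c => [|d IHd] F D c xF.
  by rewrite !big_ord0 mulr1 mul1r addr0.
rewrite !big_ord_recl mulrA xF mulrDl -mulrA.
rewrite (IHd _ (fun k => D (lift ord0 k)) (fun k => c (lift ord0 k))) //.
rewrite mulrDr -!addrA mulrA; congr (_ + _); rewrite addrC; congr (_ + _).
  by rewrite -scalerAl eqxx.
rewrite mulr_sumr; apply: eq_bigr => j _; rewrite -scalerAr; congr (_ *: _).
by rewrite big_ord_recl.
Qed.

(** An element whose commutator with the i-th row is [c i] times the i-th row
    of [D] acts on the determinant by the Leibniz rule. *)
Lemma det_leibniz d (x : A) (M D : 'M[A]_d) (c : 'I_d -> C) :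
  (forall i k, x * M i k = M i k * x + c i *: D i k) ->
  x * \det M = \det M * x +
    \sum_j c j *: \det (\matrix_(i, k) if i == j then D i k else M i k).
Proof.
move=> xM; rewrite /determinant mulr_sumr mulr_suml.
under [X in _ + X]eq_bigr => j _ do rewrite scaler_sumr.
rewrite exchange_big -big_split; apply: eq_bigr => s _ /=.
rewrite mulr_signCA -mulrA.
rewrite (prod_leibniz (D := fun k => D k (s k)) (c := c)) // mulrDr mulr_sumr.
congr (_ + _); apply: eq_bigr => j _; rewrite -scalerAr; congr (_ *: (_ * _)).
by apply: eq_bigr => k _; rewrite mxE.
Qed.
End Leibniz.

(** * Normal ordering *)

Definition cons_fun (T : finType) d (x : T) (s : {ffun 'I_d -> T}) :
    {ffun 'I_d.+1 -> T} :=
  [ffun k => oapp s x (unlift ord0 k)].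

Lemma cons_fun0 (T : finType) d (x : T) (s : {ffun 'I_d -> T}) : cons_fun x s ord0 = x.
Proof. by rewrite ffunE unlift_none. Qed.

Lemma cons_funS (T : finType) d (x : T) (s : {ffun 'I_d -> T}) k :
  cons_fun x s (lift ord0 k) = s k.
Proof. by rewrite ffunE liftK. Qed.

Lemma sum_cons_fun (V : nmodType) (T : finType) d (P : pred {ffun 'I_d.+1 -> T})
    (f : {ffun 'I_d.+1 -> T} -> V) :
  \sum_(s | P s) f s =
  \sum_(s : {ffun 'I_d -> T}) \sum_(x | P (cons_fun x s)) f (cons_fun x s).
Proof.
rewrite pair_big_dep /= (reindex (fun y : {ffun 'I_d -> T} * T => cons_fun y.2 y.1)) //.
exists (fun s : {ffun 'I_d.+1 -> T} =>
  ([ffun k : 'I_d => s (lift ord0 k)], s ord0)) => [[s x] _ | s _] /=.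
  by rewrite cons_fun0; congr (_, _); apply/ffunP=> k; rewrite ffunE cons_funS.
apply/ffunP=> k; case: (unliftP ord0 k) => [j|] ->; rewrite ?cons_fun0 ?cons_funS //.
by rewrite ffunE.
Qed.

Section NormalOrder.
Variables (C : comNzRingType) (A : algType C) (r n : nat) (P Q : 'M[A]_(r, n)).
Variables (color : 'I_r -> bool) (c : bool -> C) (g : 'M[C]_n).
Hypothesis PP : forall s a t b, P s a * P t b = P t b * P s a.
Hypothesis QP : forall s b t a, Q s b * P t a =
  P t a * Q s b + ((s == t)%:R * c (color s) * g a b)%:A.

Local Notation sdet M s I := (\det (mxsub s I M)).

Lemma sdet_cons_fun d (M : 'M[A]_(r, n)) x (s : {ffun 'I_d -> 'I_r}) I :
  sdet M (cons_fun x s) I =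
  \sum_(a < d.+1) (-1) ^+ a * (M x (I a) * sdet M s (fun k : 'I_d => I (lift a k))).
Proof.
rewrite det_expand_first; apply: eq_bigr => a _; congr (_ * (_ * _)).
  by rewrite mxE cons_fun0.
by congr determinant; apply/matrixP=> i j; rewrite !mxE cons_funS.
Qed.

(** The step that explains the shift. Expanding the determinants with first row
    [x] along that row, one has to move [Q x y] to the right of the minor of
    [P] on the remaining rows. By the Leibniz rule this costs one determinant
    for every row [s k] of that minor that equals [x], with this row replaced
    by the column [y] of [g]. Summed over [x] of colour [b], these determinants
    have first row [P (s k)] and a row [g] in position [k + 1]; exchanging the
    two rows turns each of them into minus the expansion [G] of the determinant
    with first row [g], and the shift, whose coefficient counts the rows of
    colour [b], cancels them. *)
Lemma normal_order_column d (b : bool) (s : {ffun 'I_d -> 'I_r})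
    (I : 'I_d.+1 -> 'I_n) y :
  \sum_(a < d.+1) (-1) ^+ a * ((\sum_(x | color x == b) P x (I a) * Q x y
      + (#|[set k | color (s k) == b]|%:R * c b * g (I a) y)%:A)
    * sdet P s (fun k : 'I_d => I (lift a k))) =
  \sum_(x | color x == b) sdet P (cons_fun x s) I * Q x y.
Proof.
pose G := \sum_(a < d.+1) (-1) ^+ a *
  (g (I a) y *: sdet P s (fun k : 'I_d => I (lift a k))).
pose B x (j : 'I_d) : 'M[A]_d.+1 := \matrix_(i, k)
  if unlift ord0 i is Some i' then
    if i' == j then (g (I k) y)%:A else P (s i') (I k)
  else P x (I k).
have detB j : \det (B (s j) j) = - G.
  pose B' : 'M[A]_d.+1 := \matrix_(i, k)
    if unlift ord0 i is Some i' then P (s i') (I k) else (g (I k) y)%:A.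
  have -> : B (s j) j = \matrix_(i, k) B' (tperm ord0 (lift ord0 j) i) k.
    apply/matrixP=> i k; rewrite !mxE.
    case: (unliftP ord0 i) => [i'|] ->; last by rewrite tpermL liftK.
    have [->|ij] := eqVneq i' j; first by rewrite tpermR unlift_none.
    by rewrite tpermD ?liftK // (inj_eq lift_inj) eq_sym.
  rewrite det_perm_rows => [|i1 k1 i2 k2]; last first.
    rewrite !mxE; case: (unlift ord0 i1) => [i|]; case: (unlift ord0 i2) => [i'|];
      by [exact: PP | rewrite mulr_algl mulr_algr].
  rewrite odd_tperm neq_lift mulN1r; congr (- _).
  rewrite det_expand_first; apply: eq_bigr => a _; congr (_ * _).
  rewrite mxE unlift_none mulr_algl; congr (_ *: \det _).
  by apply/matrixP=> i k; rewrite !mxE liftK.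
have Qdet x (a : 'I_d.+1) : Q x y * sdet P s (fun k : 'I_d => I (lift a k)) =
    sdet P s (fun k : 'I_d => I (lift a k)) * Q x y +
    \sum_j ((x == s j)%:R * c (color x)) *:
      \det (\matrix_(i < d, k < d) B x j (lift ord0 i) (lift a k)).
  rewrite (det_leibniz (D := \matrix_(i, k) (g (I (lift a k)) y)%:A)
    (c := fun j => (x == s j)%:R * c (color x))) => [|i k]; last first.
    by rewrite !mxE QP scalerA.
  congr (_ + _); apply: eq_bigr => j _; congr (_ *: \det _).
  by apply/matrixP=> i k; rewrite !mxE liftK.
transitivity (\sum_(a < d.+1) (-1) ^+ a * (\sum_(x | color x == b)
     (P x (I a) * sdet P s (fun k : 'I_d => I (lift a k)) * Q x y +
      P x (I a) * \sum_j ((x == s j)%:R * c (color x)) *: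
      \det (\matrix_(i < d, k < d) B x j (lift ord0 i) (lift a k)))) +
   (#|[set k | color (s k) == b]|%:R * c b) *: G).
  rewrite scaler_sumr -big_split; apply: eq_bigr => a _ /=.
  rewrite scalerAr -mulrDr; congr (_ * _); rewrite mulrDl; congr (_ + _).
    by rewrite mulr_suml; apply: eq_bigr => x _; rewrite -!mulrA Qdet mulrDr.
  by rewrite mulr_algl scalerA.
under eq_bigr => a _ do rewrite big_split mulrDr /=.
rewrite big_split -addrA [X in _ + X](_ : _ = 0) ?addr0.
  under eq_bigr => a _ do rewrite mulr_sumr.
  rewrite exchange_big; apply: eq_bigr => x _ /=.
  by rewrite sdet_cons_fun mulr_suml; apply: eq_bigr => a _; rewrite -!mulrA.
transitivity (\sum_(x | color x == b) \sum_j ((x == s j)%:R * c (color x)) *: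
    \det (B x j) + (#|[set k | color (s k) == b]|%:R * c b) *: G).
  congr (_ + _); under eq_bigr => a _ do rewrite mulr_sumr.
  rewrite exchange_big; apply: eq_bigr => x _ /=.
  under eq_bigr => a _ do rewrite !mulr_sumr.
  rewrite exchange_big; apply: eq_bigr => j _ /=.
  rewrite det_expand_first scaler_sumr; apply: eq_bigr => a _.
  by rewrite -!scalerAr [B x j _ _]mxE unlift_none.
rewrite exchange_big (bigID (fun j => color (s j) == b)) /=.
rewrite [X in _ + X + _]big1 ?addr0 => [|j sj]; last first.
  apply: big1 => x xb; case: eqVneq => [xs|_]; last by rewrite mul0r scale0r.
  by rewrite xs in xb; rewrite xb in sj.
under eq_bigr => j sj.
  rewrite (bigD1 (s j)) //= big1 ?addr0.
    rewrite eqxx mul1r (eqP sj) detB; over.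
  by move=> x /andP[_ /negPf ->]; rewrite mul0r scale0r.
by rewrite sumr_const cardsE -scaler_nat !scalerN scalerA addNr.
Qed.

(** The shift of the k-th factor: the number of factors to its right with which
    it fails to commute. *)
Definition later_same d (kap : 'I_d -> bool) (k : 'I_d) : nat :=
  #|[set j : 'I_d | (k < j)%N && (kap j == kap k)]|.

(** The k-th factor contracts [P] and [Q] over the indices [x] of one colour
    only. With one colour this gives symmetrized minors with shifts d - 1, ...,
    0; with two colours, the products of column determinants with shifts l - 1,
    ..., 0 and d - l - 1, ..., 0 up to sign. *)
Definition shifted_contraction d (kap : 'I_d -> bool) (k : 'I_d) : 'M[A]_n :=
  \matrix_(a, b) (\sum_(x | color x == kap k) P x a * Q x b
    + ((later_same kap k)%:R * c (kap k) * g a b)%:A).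

Lemma later_sameS d (kap : 'I_d.+1 -> bool) k :
  later_same kap (lift ord0 k) = later_same (fun j : 'I_d => kap (lift ord0 j)) k.
Proof.
rewrite /later_same -!sum1dep_card big_mkcond big_ord_recl /= add0n -big_mkcond.
by apply: eq_bigl => j.
Qed.

(** The Capelli identity in antisymmetrized form: with these shifts the ordered
    product of the contractions equals its normally ordered version, in which
    all entries of [P] stand to the left of those of [Q] and combine into
    minors. By induction, splitting off the first factor and applying
    [normal_order_column] to it. *)
Lemma normal_order d (kap : 'I_d -> bool) (I J : 'I_d -> 'I_n) :
  \sum_(s : 'S_d) \sum_(t : 'S_d) (-1) ^+ s * (-1) ^+ t *
    \prod_k shifted_contraction kap k (I (s k)) (J (t k)) =
  \sum_(x : {ffun 'I_d -> 'I_r} | [forall k, color (x k) == kap k])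
    sdet P x I * sdet Q x J.
Proof.
elim: d kap I J => [|d IHd] kap I J.
  rewrite (big_pred1 1%g) => [|s]; last by rewrite /= [s]permS0 eqxx.
  rewrite (big_pred1 1%g) => [|s]; last by rewrite /= [s]permS0 eqxx.
  rewrite (big_pred1 [ffun k : 'I_0 => False_rect 'I_r (notF (ltn_ord k))]).
    by rewrite big_ord0 odd_perm1 !mulr1 !det_size0 mulr1.
  move=> s /=; apply/forallP/eqP => [_|_ []//]; apply/ffunP=> -[] //.
rewrite big_lift_perm.
under eq_bigr => a _ do under eq_bigr => s _ do rewrite big_lift_perm.
transitivity (\sum_(a < d.+1) \sum_(b < d.+1) (-1) ^+ a * (-1) ^+ b *
   (shifted_contraction kap ord0 (I a) (J b) *
    \sum_(s : 'S_d) \sum_(t : 'S_d) (-1) ^+ s * (-1) ^+ t *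
    \prod_k shifted_contraction (fun k : 'I_d => kap (lift ord0 k)) k
      (I (lift a (s k))) (J (lift b (t k))))).
  apply: eq_bigr => a _; rewrite exchange_big; apply: eq_bigr => b _ /=.
  rewrite !mulr_sumr; apply: eq_bigr => s _.
  rewrite !mulr_sumr; apply: eq_bigr => t _.
  rewrite !sign_lift_perm big_ord_recl !lift_perm_id -!mulrA; congr (_ * _).
  have sgnCA (x y : A) : x * ((-1) ^+ s * ((-1) ^+ t * y)) =
      (-1) ^+ s * ((-1) ^+ t * (x * y)).
    by rewrite mulr_signCA; congr (_ * _); rewrite mulr_signCA.
  rewrite sgnCA mulr_signCA; do 4 congr (_ * _); apply: eq_bigr => k _.
  by rewrite !lift_perm_lift !mxE later_sameS.
under eq_bigr => a _ do under eq_bigr => b _ do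
  rewrite (IHd (fun k : 'I_d => kap (lift ord0 k)) (fun k : 'I_d => I (lift a k))
    (fun k : 'I_d => J (lift b k))).
rewrite sum_cons_fun [RHS](bigID (fun s : {ffun 'I_d -> 'I_r} =>
  [forall k, color (s k) == kap (lift ord0 k)])) /=.
have consP x (s : {ffun 'I_d -> 'I_r}) : [forall k, color (cons_fun x s k) == kap k] =
    (color x == kap ord0) && [forall k, color (s k) == kap (lift ord0 k)].
  apply/forallP/andP => [h|[h0 /forallP h] k].
    split; first by have := h ord0; rewrite cons_fun0.
    by apply/forallP=> k; have := h (lift ord0 k); rewrite cons_funS.
  by case: (unliftP ord0 k) => [j|] ->; rewrite ?cons_fun0 ?cons_funS.
rewrite [X in _ = _ + X]big1 ?addr0 => [|s /negPf hs]; last first.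
  by rewrite big_pred0 // => x; rewrite consP hs andbF.
under eq_bigr => a _ do under eq_bigr => b _ do rewrite mulr_sumr mulr_sumr.
under eq_bigr => a _ do rewrite exchange_big.
rewrite exchange_big; apply: eq_bigr => s hs /=.
rewrite exchange_big /=.
transitivity (\sum_(b < d.+1) (-1) ^+ b *
  ((\sum_(x | color x == kap ord0) sdet P (cons_fun x s) I * Q x (J b)) *
   sdet Q s (fun k : 'I_d => J (lift b k)))).
  apply: eq_bigr => b _; rewrite -normal_order_column mulr_suml mulr_sumr.
  apply: eq_bigr => a _; rewrite -!mulrA mulr_signCA; do 3 congr (_ * _).
  rewrite mxE -mulrA; congr (_ + _ *: _); congr (_%:R * _).
  rewrite /later_same -!sum1dep_card big_mkcond big_ord_recl /= add0n -big_mkcond.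
  by apply: eq_bigl => j /=; rewrite (eqP (forallP hs j)).
under [LHS]eq_bigr => b _ do rewrite mulr_suml mulr_sumr.
rewrite exchange_big /=; apply: eq_big => [x|x _]; first by rewrite consP hs andbT.
rewrite [X in _ = _ * X]sdet_cons_fun mulr_sumr; apply: eq_bigr => b _.
by rewrite mulr_signCA -mulrA.
Qed.
End NormalOrder.

(** * Symmetric sums over sequences *)

Lemma card_ord_interval d a b : (b <= d)%N ->
  #|[set j : 'I_d | (a <= j)%N && (j < b)%N]| = (b - a)%N.
Proof.
move=> bd; rewrite -sum1dep_card.
rewrite -(big_mkord (fun j => (a <= j)%N && (j < b)%N) (fun _ => 1%N)).
rewrite -(big_nat_widen _ _ _ (fun j => a <= j)%N) //.
rewrite -(big_nat_widenl a 0 b predT) // sum_nat_const_nat.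
exact: muln1.
Qed.

Lemma later_same_initial d l (k : 'I_d) : (l <= d)%N ->
  later_same (fun j : 'I_d => (j < l)%N) k =
  ((if (k < l)%N then l else d) - k.+1)%N.
Proof.
move=> ld; rewrite /later_same.
rewrite -(@card_ord_interval d); last by case: ifP.
apply: eq_card => j; rewrite !inE; case: (ltnP k l) => kl.
  by rewrite eqb_id.
rewrite (ltn_ord j) andbT; case: ltnP => //= kj.
by rewrite ltnNge (leq_trans kl) // ltnW.
Qed.

Lemma later_same_const d (k : 'I_d) : later_same (fun _ => true) k = (d - k.+1)%N.
Proof.
rewrite /later_same -(@card_ord_interval d) //.
by apply: eq_card => j; rewrite !inE ltn_ord.
Qed.

(** Listing [B] before its complement gives such a permutation. *)
Lemma permute_to_initial d (B : {set 'I_d}) :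
  exists r : 'S_d, forall k, (r k \in B) = (k < #|B|)%N.
Proof.
pose s := enum B ++ enum (~: B).
have s_perm : perm_eq (enum 'I_d) s.
  apply: uniq_perm; first exact: enum_uniq.
    rewrite cat_uniq !enum_uniq andbT; apply/hasP=> -[k].
    by rewrite !mem_enum inE => /negPf->.
  by move=> k; rewrite mem_enum mem_cat !mem_enum !inE orbN.
have sz : size s == d by rewrite -(perm_size s_perm) size_enum_ord.
have : perm_eq (Tuple sz) (ord_tuple d) by
  rewrite perm_sym [tval (ord_tuple d)](val_ord_tuple d).
case/tuple_permP=> r sE; exists r => k.
have -> : r k = nth k s k.
  by rewrite -[s]/(tval (Tuple sz)) sE -tnth_nth tnth_mktuple tnth_ord_tuple.
rewrite /s nth_cat -cardE; case: ltnP => h.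
  by rewrite -[X in X = _]mem_enum mem_nth // -cardE.
suff : nth k (enum (~: B)) (k - #|B|) \in enum (~: B).
  by rewrite mem_enum inE => /negPf.
by rewrite mem_nth // -cardE -(ltn_add2r #|B|) subnK // addnC cardsC card_ord.
Qed.

Section SymmetricSums.
Variables (V : zmodType) (d r : nat) (f : {ffun 'I_d -> 'I_r} -> V).
Hypothesis f_sym : forall (s : 'S_d) (x : {ffun 'I_d -> 'I_r}),
  f [ffun k => x (s k)] = f x.

(** Sort all sequences by the set of positions where they have the colour
    [true]; by symmetry these positions may be assumed to come first, and there
    are 'C(d, l) sets of [l] positions. *)
Lemma sum_by_color (color : 'I_r -> bool) :
  \sum_x f x = \sum_(l < d.+1)
    (\sum_(x : {ffun 'I_d -> 'I_r} | [forall k, color (x k) == (k < l)%N]) f x)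
      *+ 'C(d, l).
Proof.
rewrite (partition_big (fun x : {ffun 'I_d -> 'I_r} => [set k | color (x k)])
  predT) //=.
pose G (l : nat) :=
  \sum_(x : {ffun 'I_d -> 'I_r} | [forall k, color (x k) == (k < l)%N]) f x.
transitivity (\sum_(B : {set 'I_d}) G #|B|).
  apply: eq_bigr => B _; have [s sB] := permute_to_initial B.
  rewrite (reindex (fun x : {ffun 'I_d -> 'I_r} => [ffun k => x (s^-1%g k)])) /=.
    apply: eq_big => [x|x _]; last exact: f_sym.
    apply/eqP/forallP => [xB k|xB].
      by rewrite -sB -xB inE ffunE permK.
    apply/setP=> k; rewrite inE ffunE (eqP (xB _)) -sB.
    by rewrite permKV.
  exists (fun x : {ffun 'I_d -> 'I_r} => [ffun k => x (s k)]) => x _;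
    by apply/ffunP=> k; rewrite !ffunE ?permK ?permKV.
have cB (B : {set 'I_d}) : (#|B| < d.+1)%N.
  by rewrite ltnS -[X in (_ <= X)%N]card_ord max_card.
rewrite (partition_big (fun B : {set 'I_d} => Ordinal (cB B)) predT) //=.
apply: eq_bigr => l _; rewrite -/(G l).
rewrite (eq_bigr (fun _ => G l)) => [|B /eqP <-] //.
rewrite sumr_const; congr (_ *+ _); rewrite -[d in 'C(d, _)]card_ord -card_draws.
by apply: eq_card => B; rewrite inE.
Qed.

Lemma sum_symmetric :
  (forall x : {ffun 'I_d -> 'I_r}, ~~ injectiveb x -> f x = 0) ->
  \sum_x f x = (\sum_(S : dset r d) f [ffun k => elt S k]) *+ d`!.
Proof.
move=> f0; rewrite (bigID (fun x : {ffun 'I_d -> 'I_r} => injectiveb x)) /=.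
rewrite [X in _ + X]big1 ?addr0 // sum_inj_seqs -sumrMnl; apply: eq_bigr => S _.
rewrite (eq_bigr (fun _ => f [ffun k => elt S k])) => [|s _].
  by rewrite sumr_const card_Sn.
by rewrite -[RHS](f_sym s); congr f; apply/ffunP=> k; rewrite !ffunE.
Qed.
End SymmetricSums.

Section MinorProducts.
Variables (C : numFieldType) (A : algType C) (r n d : nat).
Variables (P Q : 'M[A]_(r, n)) (I : 'I_d -> 'I_n).
Hypothesis PP : forall s a t b, P s a * P t b = P t b * P s a.
Hypothesis QQ : forall s a t b, Q s a * Q t b = Q t b * Q s a.

Lemma det_mxsub_perm (M : 'M[A]_(r, n)) (x : {ffun 'I_d -> 'I_r}) (s : 'S_d) :
  (forall s a t b, M s a * M t b = M t b * M s a) ->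
  \det (mxsub [ffun k => x (s k)] I M) = (-1) ^+ s * \det (mxsub x I M).
Proof.
move=> MC; rewrite -det_perm_rows => [|i j k l]; last by rewrite !mxE.
by congr determinant; apply/matrixP=> i j; rewrite !mxE ffunE.
Qed.

(** The signs of the two minors cancel. *)
Lemma minor_prod_sym (s : 'S_d) (x : {ffun 'I_d -> 'I_r}) :
  \det (mxsub [ffun k => x (s k)] I P) * \det (mxsub [ffun k => x (s k)] I Q) =
  \det (mxsub x I P) * \det (mxsub x I Q).
Proof.
rewrite !det_mxsub_perm // -mulrA mulr_signCA mulrA -signr_addb addbb.
exact: mul1r.
Qed.

Lemma minor_prod_noninj (x : {ffun 'I_d -> 'I_r}) : ~~ injectiveb x ->
  \det (mxsub x I P) * \det (mxsub x I Q) = 0.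
Proof.
move/injectivePn=> [i [j ij xij]]; rewrite (_ : \det (mxsub x I P) = 0) ?mul0r //.
apply: (@eq_oppr_eq0 C); rewrite -mulN1r.
have -> : -1 = (-1) ^+ tperm i j :> A by rewrite odd_tperm ij.
rewrite -det_mxsub_perm //; congr determinant.
by apply/matrixP=> k l; rewrite !mxE ffunE; case: tpermP => [->|->|]; rewrite ?xij.
Qed.
End MinorProducts.

Section ContractionTrace.
Variables (C : numFieldType) (A : algType C) (r n : nat) (P Q : 'M[A]_(r, n)).
Variables (color : 'I_r -> bool) (c : bool -> C) (g : 'M[C]_n).
Hypothesis PP : forall s a t b, P s a * P t b = P t b * P s a.
Hypothesis QQ : forall s a t b, Q s a * Q t b = Q t b * Q s a.
Hypothesis QP : forall s b t a, Q s b * P t a =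
  P t a * Q s b + ((s == t)%:R * c (color s) * g a b)%:A.

Lemma alt_trace_contraction d (kap : 'I_d -> bool) :
  alt_trace (shifted_contraction P Q color c g kap) =
  \sum_(J : dset n d)
    \sum_(x : {ffun 'I_d -> 'I_r} | [forall k, color (x k) == kap k])
      \det (mxsub x (elt J) P) * \det (mxsub x (elt J) Q).
Proof. by rewrite alt_trace_sets; apply: eq_bigr => J _; rewrite normal_order. Qed.

Lemma sum_minor_prod d (J : dset n d) :
  (d`!%:R^-1 : C) *: (\sum_(x : {ffun 'I_d -> 'I_r})
     \det (mxsub x (elt J) P) * \det (mxsub x (elt J) Q)) =
  \sum_(S : dset r d) minor P S J * minor Q S J.
Proof.
rewrite (sum_symmetric (f := fun x =>
  \det (mxsub x (elt J) P) * \det (mxsub x (elt J) Q))); last 2 first.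
- by move=> s x; apply: minor_prod_sym.
- by move=> x; apply: minor_prod_noninj.
rewrite -scaler_nat scalerA mulVf ?scale1r ?pnatr_eq0 -?lt0n ?fact_gt0 //.
by apply: eq_bigr => S _; congr (_ * _); congr determinant;
  apply/matrixP=> i j; rewrite !mxE ffunE.
Qed.

(** The form of the normal ordering needed for the symmetrized minors. By
    symmetry and antisymmetry, the sum over sequences of row indices is d!
    times the sum over subsets. *)
Lemma contraction_trace d : (forall s, color s) ->
  (d`!%:R^-1 : C) *: alt_trace (shifted_contraction P Q color c g
     (fun _ : 'I_d => true)) =
  \sum_(S : dset r d) \sum_(J : dset n d) minor P S J * minor Q S J.
Proof.
move=> all_color; rewrite alt_trace_contraction [RHS]exchange_big scaler_sumr.
apply: eq_bigr => J _ /=; rewrite -sum_minor_prod; congr (_ *: _).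
by apply: eq_bigl => x; apply/forallP=> k; rewrite all_color.
Qed.

Lemma minor_tr (M : 'M[A]_(r, n)) d (S : dset r d) (J : dset n d) :
  (forall s a t b, M s a * M t b = M t b * M s a) ->
  minor M^T J S = minor M S J.
Proof.
move=> MC; rewrite /minor -det_tr_comm => [|i j k l]; last by rewrite !mxE.
by congr determinant; apply/matrixP=> i j; rewrite !mxE.
Qed.

(** The form needed for the products of column determinants. The l-th trace
    only yields the sequences whose first [l] entries have colour [true] and
    the others colour [false]; the weights 1/(l! (d - l)!) = 'C(d, l)/d! are
    those for which the sum over [l] is the average over all sequences. *)
Lemma colored_contraction_trace d :
  \sum_(l < d.+1) ((l`! * (d - l)`!)%:R^-1 : C) *: alt_trace
     (shifted_contraction P Q color c g (fun k : 'I_d => (k < l)%N)) =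
  \sum_(J : dset n d) \sum_(S : dset r d) minor P^T J S * minor Q^T J S.
Proof.
under eq_bigr => l _ do rewrite alt_trace_contraction scaler_sumr.
rewrite exchange_big; apply: eq_bigr => J _ /=.
under [RHS]eq_bigr => S _ do rewrite !minor_tr //.
rewrite -sum_minor_prod (sum_by_color _ color); last first.
  by move=> s x; apply: minor_prod_sym.
rewrite scaler_sumr; apply: eq_bigr => l _.
rewrite -scaler_nat scalerA; congr (_ *: _).
have ld : (l <= d)%N by rewrite -ltnS.
rewrite -(bin_fact ld) [('C(d, l) * _)%:R]natrM invfM mulrAC mulVf ?mul1r //.
by rewrite pnatr_eq0 -lt0n bin_gt0.
Qed.
End ContractionTrace.

(** * Images under the Weil representation *)

Section Weil.
Variables (C : numClosedFieldType) (m p q : nat).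
Local Notation PD := (PD C m p q).
Local Notation P := (matP C m p q).
Local Notation Q := (matQ C m p q).

Lemma matP_comm s a t b : P s a * P t b = P t b * P s a.
Proof.
case: (split_ordP a) => i ->; case: (split_ordP b) => j ->;
  rewrite ?row_mxEl ?row_mxEr !mxE;
  by [exact: weyl_xC | exact: weyl_dC | rewrite weyl_dxC ?idxXY ?idxYX].
Qed.

Lemma matQ_comm s a t b : Q s a * Q t b = Q t b * Q s a.
Proof.
case: (split_ordP a) => i ->; case: (split_ordP b) => j ->;
  rewrite ?row_mxEl ?row_mxEr !mxE;
  by [exact: weyl_xC | exact: weyl_dC | rewrite weyl_dxC ?idxXY ?idxYX].
Qed.

(** The sign in the last q columns comes from the order of the roles: there [Q]
    consists of coordinates and [P] of derivations. *)
Lemma matQP s b t a :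
  Q s b * P t a = P t a * Q s b + ((s == t)%:R * Ipq C p q a b)%:A.
Proof.
case: (split_ordP b) => j ->; case: (split_ordP a) => i ->;
  rewrite ?row_mxEl ?row_mxEr ?block_mxEul ?block_mxEur ?block_mxEdl ?block_mxEdr !mxE.
- by rewrite weyl_dx idxX_eq [j == i]eq_sym -natrM mulnb scaler_nat.
- by rewrite mulr0 scale0r addr0 weyl_dC.
- by rewrite mulr0 scale0r addr0 weyl_xC.
rewrite weyl_dx idxY_eq [t == s]eq_sym mulrN -natrM mulnb scaleNr scaler_nat.
by rewrite addrK.
Qed.

(** The diagonal of [I_{p,q}]. *)
Let eps (a : 'I_(p + q)) : C := if split a is inl _ then 1 else -1.
(** The inverse of the diagonal of [D]. *)
Let e (a : 'I_(p + q)) : C := if split a is inl _ then 1 else 'i.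

Lemma IpqE a b : Ipq C p q a b = eps a *+ (a == b).
Proof.
rewrite /eps; case: (split_ordP a) => i ->; case: (split_ordP b) => j ->;
rewrite ?block_mxEul ?block_mxEur ?block_mxEdl ?block_mxEdr !mxE.
- by rewrite (inj_eq (@lshift_inj _ _)).
- by rewrite eq_lrshift.
- by rewrite eq_rlshift.
by rewrite (inj_eq (@rshift_inj _ _)) mulNrn.
Qed.

Lemma matDE a b : matD C p q a b = (e a)^-1 *+ (a == b).
Proof.
rewrite /e; case: (split_ordP a) => i ->; case: (split_ordP b) => j ->;
rewrite ?block_mxEul ?block_mxEur ?block_mxEdl ?block_mxEdr !mxE.
- by rewrite (inj_eq (@lshift_inj _ _)) invr1.
- by rewrite eq_lrshift.
- by rewrite eq_rlshift.
by rewrite (inj_eq (@rshift_inj _ _)) invCi.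
Qed.

Lemma e_neq0 a : e a != 0.
Proof. by rewrite /e; case: split => _; rewrite ?oner_eq0 ?neq0Ci. Qed.

(** The matrix [D] is chosen so that the factors sqrt(-1) disappear from
    omega(B), which becomes [P^T Q + m/2 I_{p,q}]. *)
Lemma omega_C_factor d (W : {lrmorphism Um C p q -> PD}) (k : 'I_d) :
  (forall i j, W (uea_gen (delta_mx i j)) = omegaB C m p q i j) ->
  map_mx W (C_factor C m p q k) = shifted_contraction P Q (fun _ => true) (fun _ => 1)
    (Ipq C p q) (fun _ : 'I_d => true) k.
Proof.
move=> WE; rewrite map_mxD map_in_alg /matB !map_mxM !map_in_alg.
have -> : map_mx W (matB' C p q) = omegaB C m p q.
  by apply/matrixP=> i j; rewrite [LHS]mxE [matB' _ _ _ _ _]mxE WE.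
apply/matrixP=> a b; rewrite mxE map_conjE.
rewrite (bigD1 a) //= (bigD1 b) //= !big1 ?addr0; last first.
- by move=> f /negPf fb; rewrite !matDE fb mulr0n mulr0 scale0r.
- move=> c /negPf ca; apply: big1 => f _.
  by rewrite !matDE eq_sym ca mulr0n mul0r scale0r.
rewrite !matDE !eqxx !mulr1n omegaBE [X in _ *: X + _]mxE -/(e a) -/(e b).
rewrite scalerA mulrACA !mulVf ?e_neq0 // mulr1 scale1r -/(eps a) [RHS]mxE.
rewrite [map_mx _ _ _ _]mxE [(_ *: Ipq _ _ _) _ _]mxE IpqE /=.
rewrite -addrA; congr (_ + _); rewrite -scalerDl; congr (_ *: _).
rewrite mulr1 -mulrnAr -mulrDl addrC subrK; congr (_%:R * _).
by rewrite later_same_const.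
Qed.

Lemma omega_C_elt d :
  omega_m m (C_elt C m p q d) =
  \sum_(S : dset m d) \sum_(J : dset (p + q) d) minor P S J * minor Q S J.
Proof.
pose W : {lrmorphism Um C p q -> PD} := omega_m (C := C) (p := p) (q := q) m.
have WE i j : W (uea_gen (delta_mx i j)) = omegaB C m p q i j.
  exact: omega_mB.
rewrite -[LHS]/(W _); move: W WE => W WE.
rewrite C_eltE linearZ /= rmorph_alt_trace.
rewrite (eq_alt_trace (fun k => omega_C_factor k WE)).
apply: contraction_trace => //; [exact: matP_comm|exact: matQ_comm|].
by move=> s b t a; rewrite mulr1 matQP.
Qed.

(** The colour of a column of [P] and [Q]: [true] for X, [false] for Y. *)
Let color (x : 'I_(p + q)) : bool := if split x is inl _ then true else false.
(** The commutator of the entries of [Q] and [P] in a column of the given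
    colour. *)
Let sgn (b : bool) : C := if b then 1 else -1.

Lemma color_lshift i : color (lshift q i).
Proof. by rewrite /color (unsplitK (inl i : 'I_p + 'I_q)). Qed.

Lemma color_rshift i : color (rshift p i) = false.
Proof. by rewrite /color (unsplitK (inr i : 'I_p + 'I_q)). Qed.

(** Here the roles are exchanged: the contraction is over the columns of [P]
    and [Q], coloured by whether they belong to X or to Y. The parameter alpha
    cancels the p/2 of omega, whereas beta doubles the q/2, and adding q moves
    the derivations of Y to the left of the coordinates. *)
Lemma omega_X_factor d l (W : {lrmorphism Ug C m -> PD}) (k : 'I_d) : (l <= d)%N ->
  (forall s t, W (uea_gen (delta_mx s t, 0)) = omegaX C m p q s t) ->
  (forall s t, W (uea_gen (0, delta_mx s t)) = omegaY C m p q s t) ->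
  map_mx W (X_factor C m p q l k) =
  shifted_contraction P^T Q^T color sgn 1%:M (fun j : 'I_d => (j < l)%N) k.
Proof.
move=> ld WX WY.
have mapX : map_mx W (EX C m) = omegaX C m p q.
  by apply/matrixP=> a b; rewrite [LHS]mxE [EX _ _ _ _]mxE WX.
have mapY : map_mx W (EY C m)^T = (omegaY C m p q)^T.
  by apply/matrixP=> a b; rewrite [LHS]mxE [_^T _ _]mxE [EY _ _ _ _]mxE WY [RHS]mxE.
apply/matrixP=> a b; rewrite [RHS]mxE later_same_initial //.
rewrite /X_factor big_split_ord /=; case: (ltnP k l) => kl;
  rewrite map_mxD map_in_alg ?mapX ?mapY mxE [map_mx _ _ _ _]mxE [_%:M _ _]mxE.
  rewrite [X in _ = _ + X + _]big_pred0 ?addr0 => [|i]; last by rewrite color_rshift.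
  rewrite [X in _ = X + _](eq_bigl predT) => [|i]; last by rewrite color_lshift.
  rewrite [omegaX _ _ _ _ _ _]mxE [1%:M _ _]mxE /= -addrA -scalerDl.
  congr (_ + _ *: _).
    by apply: eq_bigr => i _; rewrite ![(_)^T _ _]mxE !row_mxEl.
  by rewrite /sgn mulr1 -mulrnDl addrC subrK mulr_natr.
rewrite [X in _ = X + _ + _]big_pred0 ?add0r => [|i]; last by rewrite color_lshift.
rewrite [X in _ = X + _](eq_bigl predT) => [|i]; last by rewrite color_rshift.
rewrite [_^T _ _]mxE [omegaY _ _ _ _ _ _]mxE [1%:M _ _]mxE /=.
under [X in _ = X + _]eq_bigr => i _.
  rewrite ![(_)^T _ _]mxE !row_mxEr ![matDY _ _ _ _ _ _]mxE ![matY _ _ _ _ _ _]mxE.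
  rewrite weyl_dx idxY_eq eqxx andbT; over.
rewrite big_split /= -!addrA; congr (_ + _).
  by apply: eq_bigr => i _; rewrite !mxE.
rewrite sumr_const card_ord -!mulrnA -[_ *+ (_ * q)]scaler_nat -!scalerDl.
congr (_ *: _).
rewrite [b == a]eq_sym; case: (a == b) => /=; last by rewrite !mulr0n mulr0 !addr0.
by rewrite !mulr1n mul1n mulrN1 mulr1 addrCA -splitr addrC.
Qed.

Lemma omega_X_elt d :
  omega_g p q (X_elt C m p q d) =
  \sum_(S : dset m d) \sum_(J : dset (p + q) d) minor P S J * minor Q S J.
Proof.
pose W : {lrmorphism Ug C m -> PD} := omega_g (C := C) (m := m) p q.
have WX i j : W (uea_gen (delta_mx i j, 0)) = omegaX C m p q i j.
  exact: omega_gX.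
have WY i j : W (uea_gen (0, delta_mx i j)) = omegaY C m p q i j.
  exact: omega_gY.
rewrite -[LHS]/(W _); move: W WX WY => W WX WY.
transitivity (\sum_(l < d.+1) ((l`! * (d - l)`!)%:R^-1 : C) *:
  alt_trace (shifted_contraction P^T Q^T color sgn 1%:M
      (fun k : 'I_d => (k < l)%N))).
  rewrite X_eltE linear_sum; apply: eq_bigr => l _.
  rewrite linearZ /= rmorph_alt_trace; congr (_ *: _).
  by apply: eq_alt_trace => k; apply: omega_X_factor => //; rewrite -ltnS.
rewrite colored_contraction_trace ?trmxK //.
- by move=> s a t b; rewrite ![_^T _ _]mxE matP_comm.
- by move=> s a t b; rewrite ![_^T _ _]mxE matQ_comm.
move=> s b t a; rewrite ![_^T _ _]mxE matQP; congr (_ + _ *: _).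
rewrite IpqE [1%:M _ _]mxE [b == a]eq_sym [t == s]eq_sym /eps /sgn /color.
case: (eqVneq s t) => [->|_]; last by rewrite mulr0n mulr0 !mul0r.
by rewrite mulr1n mul1r mulrC; case: split.
Qed.
End Weil.

Theorem theorem2p1 (R : realType) (m p q d : nat) (m_gt0 : (0 < m)%N)
    (d_gt0 : (0 < d)%N) :
  [/\ K_invariant (X_elt R[i] m p q d),
      H_invariant (C_elt R[i] m p q d),
      omega_g p q (X_elt R[i] m p q d) =
        \sum_(S : dset m d) \sum_(J : dset (p + q) d)
          minor (matP R[i] m p q) S J * minor (matQ R[i] m p q) S J
    & \sum_(S : dset m d) \sum_(J : dset (p + q) d)
          minor (matP R[i] m p q) S J * minor (matQ R[i] m p q) S J =
        omega_m m (C_elt R[i] m p q d)].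
Proof.
split.
- exact: X_elt_invariant.
- exact: C_elt_invariant.
- exact: omega_X_elt.
- by rewrite omega_C_elt.
Qed.
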